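(* Let $n\ge2$. For any integers $1\le t\le l-1$ we have $$\lim_{\substack{L\to\infty\\ L\equiv0\,(n)}}q^{-\frac{tL(L-n)}{2n}}F^{(l)}_{(t^L)}(q)=\sum_\eta\frac{F^{(l-t)'}_\eta(q)\,F^{(t)'}_\eta(q)}{(q)_{\zeta_1}\cdots(q)_{\zeta_{n-1}}},\qquad\eta=\bigl((n-1)^{\zeta_{n-1}},\dots,1^{\zeta_1}\bigr),$$ where the sum runs over the partitions $\eta$ of this form (i.e. with $\eta_1\le n-1$) satisfying $|\eta|\equiv0\bmod n$.
   Context: Limits are coefficientwise as formal power series in $q$. $(q)_m=\prod_{i=1}^m(1-q^i)$; $\begin{bmatrix} m \\ k \end{bmatrix}=\frac{(q)_m}{(q)_k(q)_{m-k}}$ if $0\le k\le m$, else $0$. $n(\mu)=\sum_{i\ge1}\binom{\mu'_i}2$ ($\mu'$ the conjugate partition). $C^{(k)}_{ij}=2\delta_{ij}-\delta_{i,j+1}-\delta_{i,j-1}$, $C^{(k)-1}_{ij}=\min(i,j)-ij/k$ for $1\le i,j\le k-1$. **$F^{(l)}_\mu(q)$.** For a partition $\mu$ with $|\mu|\equiv0\bmod n$ and $\mu_1\le l$, $$F^{(l)}_\mu(q)=\sum_{\{m\}}q^{c_l(\{m\})}\prod_{\substack{1\le a\le n-1\\ 1\le i\le l-1}}\begin{bmatrix} p^{(a)}_i+m^{(a)}_i \\ m^{(a)}_i \end{bmatrix},$$ $$c_l(\{m\})=n(\mu)+\tfrac12\sum_{1\le a,b\le n-1}C^{(n)}_{ab}\sum_{1\le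 j,k\le l}\min(j,k)m^{(a)}_jm^{(b)}_k-\sum_{k\ge1}\sum_{j=1}^l\min(j,\mu_k)m^{(1)}_j,$$ $$p^{(a)}_i=\delta_{a1}\sum_{k\ge1}\min(i,\mu_k)-\sum_{b=1}^{n-1}C^{(n)}_{ab}\sum_{k=1}^l\min(i,k)m^{(b)}_k,$$ the sum being over $\{m^{(a)}_i\in\mathbf Z_{\ge0}\mid1\le a\le n-1,1\le i\le l\}$ with $p^{(a)}_i\ge0$ for $1\le a\le n-1$, $1\le i\le l-1$, and $\sum_{i=1}^li\,m^{(a)}_i=\frac{n-a}n|\mu|$ for $1\le a\le n-1$. **$F^{(l)'}_\eta(q)$.** For $l\ge1$ and $\eta=((n-1)^{\zeta_{n-1}}\cdots1^{\zeta_1})$ with $|\eta|\equiv0\bmod n$, $$F^{(l)'}_\eta(q)=\sum_{\{\tilde m\}}q^{\tilde c_l(\{\tilde m\})}\prod_{\substack{1\le a\le n-1\\ 1\le i\le l-1}}\begin{bmatrix} \tilde p^{(a)}_i+\tilde m^{(a)}_i \\ \tilde m^{(a)}_i \end{bmatrix},$$ $$\tilde c_l(\{\tilde m\})=\tfrac12\sum_{1\le a,b\le n-1}C^{(n)}_{ab}\sum_{1\le j,k\le l}\min(j,k)\tilde m^{(a)}_j\tilde m^{(b)}_k,\qquad \tilde p^{(a)}_i=C^{(l)-1}_{1i}\zeta_a-\sum_{b=1}^{n-1}C^{(n)}_{ab}\sum_{k=1}^{l-1}C^{(l)-1}_{ik}\tilde m^{(b)}_k,$$ the sum being over $\{\tilde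 m^{(a)}_i\in\mathbf Z_{\ge0}\mid1\le a\le n-1,1\le i\le l\}$ with $\tilde p^{(a)}_i\ge0$ for $1\le a\le n-1$, $1\le i\le l-1$, and $\sum_{i=1}^li\,\tilde m^{(a)}_i=\sum_{b=1}^{n-1}C^{(n)-1}_{ab}\zeta_b$ for $1\le a\le n-1$. *)

(* Defs.v *)
From mathcomp Require Import all_boot all_order all_algebra.
From mathcomp Require Import finmap zify ring.
From mathcomp Require Import boolp classical_sets functions cardinality fsbigop.

Set Implicit Arguments.
Unset Strict Implicit.
Unset Printing Implicit Defensive.

Import Order.TTheory GRing.Theory Num.Theory.
Local Open Scope ring_scope.
Local Open Scope classical_set_scope.

(* Polynomials in q are elements of {poly rat}; the variable q is 'X. *)

Definition qpoch (m : nat) : {poly rat} := \prod_(1 <= i < m.+1) (1 - 'X^i).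

(* The division is exact, see [qbinE]. *)
Definition qbin (m k : nat) : {poly rat} :=
  if (k <= m)%N then qpoch m %/ (qpoch k * qpoch (m - k)) else 0.

Definition is_part (mu : seq nat) : bool := sorted geq mu && (0%N \notin mu).

Definition conj_part (mu : seq nat) (i : nat) : nat := count (leq i) mu.

Definition nstat (mu : seq nat) : nat :=
  \sum_(1 <= i < (head 0%N mu).+1) 'C(conj_part mu i, 2).

(* Entries of the Cartan matrix C^(k) and of its inverse, with 1-based indices
   1 <= i, j <= k - 1.  The former do not depend on k. *)
Definition cartan (i j : nat) : rat :=
  2 * (i == j)%:R - (i == j.+1)%:R - (i.+1 == j)%:R.

Definition cartan_inv (k i j : nat) : rat :=
  (minn i j)%:R - (i * j)%N%:R / k%:R.

(* A family m^(a)_i, 1 <= a <= n - 1, 1 <= i <= l, is a matrix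
   m : 'M[nat]_(n.-1, l) with m^(a)_i stored at row a - 1, column i - 1;
   hence the shifts a.+1 and i.+1 in the formulas below. *)

(* The exponent \tilde c_l. *)
Definition energy r l (m : 'M[nat]_(r, l)) : rat :=
  2^-1 * \sum_(a < r) \sum_(b < r) cartan a.+1 b.+1 *
    \sum_(j < l) \sum_(k < l) (minn j.+1 k.+1)%:R * (m a j)%:R * (m b k)%:R.

(* The exponent c_l; the row a = 1 of m is selected by (a == 0). *)
Definition charge r l (mu : seq nat) (m : 'M[nat]_(r, l)) : rat :=
  (nstat mu)%:R + energy m
  - \sum_(x <- mu) \sum_(a < r | a == 0%N :> nat) \sum_(j < l)
      (minn j.+1 x)%:R * (m a j)%:R.

(* The vacancy numbers p^(a)_i. *)
Definition vacancy r l (mu : seq nat) (m : 'M[nat]_(r, l))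
    (a : 'I_r) (i : 'I_l) : rat :=
  (a.+1 == 1%N)%:R * \sum_(x <- mu) (minn i.+1 x)%:R
  - \sum_(b < r) cartan a.+1 b.+1 *
      \sum_(k < l) (minn i.+1 k.+1)%:R * (m b k)%:R.

Definition F_index (n l : nat) (mu : seq nat) : set 'M[nat]_(n.-1, l) :=
  [set m | (forall (a : 'I_n.-1) (i : 'I_l), (i.+1 < l)%N ->
              0 <= vacancy mu m a i) /\
           (forall a : 'I_n.-1,
              \sum_(i < l) i.+1%:R * (m a i)%:R
              = (n - a.+1)%N%:R / n%:R * (sumn mu)%:R :> rat)].

Arguments F_index : clear implicits.

(* Exponents and vacancy numbers are natural numbers on the index set, see
   [charge_nat] and [vacancy_nat], so Num.truncn is a mere change of type.
   The index set is finite, see [finite_F_index]. *)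
Definition F (n l : nat) (mu : seq nat) : {poly rat} :=
  \sum_(m \in F_index n l mu)
    'X^(Num.truncn (charge mu m)) *
    \prod_(a < n.-1) \prod_(i < l | (i.+1 < l)%N)
      qbin (Num.truncn (vacancy mu m a i) + m a i) (m a i).

(* For eta = ((n-1)^zeta_{n-1}, ..., 1^zeta_1), zeta_a = multiplicity eta a. *)
Definition multiplicity (eta : seq nat) (a : nat) : nat := count_mem a eta.

(* The vacancy numbers \tilde p^(a)_i. *)
Definition vacancy' r l (eta : seq nat) (m : 'M[nat]_(r, l))
    (a : 'I_r) (i : 'I_l) : rat :=
  cartan_inv l 1 i.+1 * (multiplicity eta a.+1)%:R
  - \sum_(b < r) cartan a.+1 b.+1 *
      \sum_(k < l | (k.+1 < l)%N) cartan_inv l i.+1 k.+1 * (m b k)%:R.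

Definition F'_index (n l : nat) (eta : seq nat) : set 'M[nat]_(n.-1, l) :=
  [set m | (forall (a : 'I_n.-1) (i : 'I_l), (i.+1 < l)%N ->
              0 <= vacancy' eta m a i) /\
           (forall a : 'I_n.-1,
              \sum_(i < l) i.+1%:R * (m a i)%:R
              = \sum_(b < n.-1) cartan_inv n a.+1 b.+1
                  * (multiplicity eta b.+1)%:R :> rat)].

Arguments F'_index : clear implicits.

(* See [energy_nat], [vacancy'_nat] and [finite_F'_index]. *)
Definition F' (n l : nat) (eta : seq nat) : {poly rat} :=
  \sum_(m \in F'_index n l eta)
    'X^(Num.truncn (energy m)) *
    \prod_(a < n.-1) \prod_(i < l | (i.+1 < l)%N)
      qbin (Num.truncn (vacancy' eta m a i) + m a i) (m a i).

(* A formal series in q with exponents in Z is the function sending an exponent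
   to its coefficient. *)
Definition series := int -> rat.

(* q^(-N) P *)
Definition shifted_poly (N : int) (P : {poly rat}) : series :=
  fun j => if j + N is Posz k then P`_k else 0.

(* The power series P / Q for Q with constant term 1, expanded with the
   geometric series 1 / Q = \sum_i (1 - Q)^i; see [quo_seriesP]. *)
Definition quo_series (P Q : {poly rat}) : series :=
  fun j => if j is Posz k then (P * \sum_(i < k.+1) (1 - Q) ^+ i)`_k else 0.

(* Coefficientwise limit of f L as L tends to infinity with L in A; the
   coefficients carry the discrete topology. *)
Definition has_qlim (A : pred nat) (f : nat -> series) (s : series) : Prop :=
  forall j : int, exists L0 : nat,
    forall L : nat, (L0 <= L)%N -> A L -> f L j = s j.

(* The family (f x), x in A, is summable in the coefficientwise sense, with
   sum s. *)
Definition has_qsum (T : choiceType) (A : set T) (f : T -> series)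
    (s : series) : Prop :=
  forall j : int, finite_set [set x | A x /\ f x j != 0] /\
    s j = \sum_(x \in A) f x j.

Lemma qpochS m : qpoch m.+1 = qpoch m * (1 - 'X^(m.+1)).
Proof. by rewrite /qpoch big_nat_recr. Qed.

Lemma qpoch_coef0 m : (qpoch m)`_0 = 1.
Proof.
elim: m => [|m IH]; first by rewrite /qpoch big_geq // coefC.
by rewrite qpochS mulrBr mulr1 coefB coefMXn /= subr0.
Qed.

Lemma qpoch_neq0 m : qpoch m != 0.
Proof. by apply/eqP => h; have := qpoch_coef0 m; rewrite h coef0. Qed.

Lemma qpoch_dvd k j : qpoch k * qpoch j %| qpoch (k + j).
Proof.
have [s] := ubnP (k + j); elim: s k j => // s IH [|k] [|j] hs.
- by rewrite /qpoch big_geq // mul1r dvdpp.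
- by rewrite /qpoch big_geq // mul1r dvdpp.
- by rewrite addn0 /qpoch [X in _ * X]big_geq // mulr1 dvdpp.
rewrite addSn (qpochS (k + j.+1)).
have -> : 1 - 'X^((k + j.+1).+1)%N
    = (1 - 'X^(k.+1)) + 'X^(k.+1) * (1 - 'X^(j.+1)) :> {poly rat}.
  by rewrite -addSn exprD; ring.
rewrite mulrDr dvdp_add //.
- rewrite qpochS mulrAC dvdp_mul2r ?IH //.
  apply/eqP => h; have := qpoch_coef0 k.+1.
  by rewrite qpochS h mulr0 coef0.
- rewrite mulrCA dvdp_mull // (qpochS j) mulrA dvdp_mul2r.
    by rewrite addnS -addSn IH //; lia.
  apply/eqP => h; have := qpoch_coef0 j.+1.
  by rewrite qpochS h mulr0 coef0.
Qed.

Lemma qbinE m k : (k <= m)%N ->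
  qbin m k * (qpoch k * qpoch (m - k)) = qpoch m.
Proof.
by move=> km; rewrite /qbin km divpK // -{2}(subnKC km) qpoch_dvd.
Qed.

Lemma quo_seriesP (P Q : {poly rat}) (k : nat) : Q`_0 = 1 ->
  \sum_(i < k.+1) Q`_i * quo_series P Q (k - i)%N = P`_k.
Proof.
move=> Q0; set G := fun k => \sum_(i < k.+1) (1 - Q) ^+ i.
have lowU i j : (j < i)%N -> ((1 - Q) ^+ i)`_j = 0.
  elim: i j => // i IH j ji; rewrite exprS coefM big1 // => -[[|u] hu] _ /=.
    by rewrite coefB coefC Q0 /= subrr mul0r.
  by rewrite IH ?mulr0 //; lia.
have lowG j i : (j <= k)%N -> (i <= j)%N -> (G j)`_i = (G k)`_i.
  move=> jk ij.
  have -> : G k = G j + \sum_(u < k - j) (1 - Q) ^+ (j.+1 + u).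
    have -> : G k = G (j + (k - j))%N by rewrite subnKC.
    by rewrite /G -addSn big_split_ord.
  rewrite coefD -[LHS]addr0; congr (_ + _); rewrite coef_sum big1 // => u _.
  by apply: lowU; lia.
have -> : \sum_(i < k.+1) Q`_i * quo_series P Q (k - i)%N
        = (Q * (P * G k))`_k.
  rewrite coefM; apply: eq_bigr => i _; congr (_ * _).
  rewrite /quo_series -/(G _) !coefM; apply: eq_bigr => j _; congr (_ * _).
  by apply: lowG; lia.
have -> : Q * (P * G k) = P - P * (1 - Q) ^+ k.+1.
  have : 1 - (1 - Q) ^+ k.+1 = Q * G k.
    by rewrite -opprB subrX1 -/(G k) -mulNr; congr (_ * _); ring.
  by move=> h; rewrite mulrCA -h; ring.
rewrite coefB coefM big1 ?subr0 // => i _.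
by rewrite lowU ?mulr0 //; lia.
Qed.

Lemma cartan_sum (r a : nat) (f : nat -> rat) : (a < r)%N ->
  f 0%N = 0 -> f r.+1 = 0 ->
  \sum_(b < r) cartan a.+1 b.+1 * f b.+1 = 2 * f a.+1 - f a - f a.+2.
Proof.
move=> ar f0 fr.
have delta c : \sum_(b < r) (c == b :> nat)%:R * f b.+1
    = if (c < r)%N then f c.+1 else 0.
  case: ifPn => cr; last first.
    rewrite big1 // => b _; case: eqP => [cb|]; last by rewrite mul0r.
    by move: cr; rewrite cb ltn_ord.
  rewrite (bigD1 (Ordinal cr)) //= eqxx mul1r big1 ?addr0 // => b hb.
  case: eqP => [cb|]; last by rewrite mul0r.
  by case/eqP: hb; apply/val_inj.
under eq_bigr do rewrite /cartan !eqSS !mulrBl -mulrA.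
rewrite !sumrB -mulr_sumr !delta ar; congr (_ - _ - _).
- case: a ar => [|a] ar.
    by rewrite f0 big1 // => b _; rewrite mul0r.
  under eq_bigr do rewrite eqSS.
  by rewrite delta ifT //; lia.
- case: ifPn => // h; have -> : a.+2 = r.+1 by lia.
  by rewrite fr.
Qed.

Lemma cartan_invP (n a c : nat) : (a < n.-1)%N -> (c < n.-1)%N ->
  \sum_(b < n.-1) cartan a.+1 b.+1 * cartan_inv n b.+1 c.+1 = (a == c)%:R.
Proof.
case: n => [|n] //= ha hc.
have n0 : n.+1%:R != 0 :> rat by rewrite pnatr_eq0.
rewrite (cartan_sum (f := fun b => cartan_inv n.+1 b c.+1)) //.
- rewrite /cartan_inv.
  have -> : ((a.+1 * c.+1)%N%:R = (a * c.+1)%N%:R + c.+1%:R :> rat)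
    by rewrite mulSn natrD addrC.
  have -> : ((a.+2 * c.+1)%N%:R = (a * c.+1)%N%:R + c.+1%:R + c.+1%:R :> rat)
    by rewrite !mulSn !natrD; ring.
  have e : ((2 * minn a.+1 c.+1) = (a == c) + minn a c.+1 + minn a.+2 c.+1)%N.
    by case: eqP => ?; lia.
  have /(congr1 (fun x => x%:R : rat)) := e.
  rewrite natrM !natrD => e'.
  have -> : (a == c)%:R = 2 * (minn a.+1 c.+1)%:R - (minn a c.+1)%:R
    - (minn a.+2 c.+1)%:R :> rat by rewrite e'; ring.
  by field; rewrite nat1r.
- by rewrite /cartan_inv min0n mul0n mul0r subrr.
- rewrite /cartan_inv natrM mulrAC divff // mul1r.
  by rewrite (_ : minn n.+1 c.+1 = c.+1) ?subrr //; lia.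
Qed.

Lemma cartan_diag i : cartan i i = 2.
Proof. by rewrite /cartan eqxx (ltn_eqF (ltnSn i)) (gtn_eqF (ltnSn i)) mulr1 !subr0. Qed.

Lemma cartan_near_l i : cartan i i.+1 = -1.
Proof.
by rewrite /cartan eqxx (ltn_eqF (ltnSn i)) (ltn_eqF (leqnSn i.+1)) mulr0 subr0 add0r.
Qed.

Lemma cartan_near_r i : cartan i.+1 i = -1.
Proof.
by rewrite /cartan eqxx (gtn_eqF (ltnSn i)) (gtn_eqF (leqnSn i.+1)) mulr0 subr0 add0r.
Qed.

Lemma cartan_far_l i j : (i.+1 < j)%N -> cartan i j = 0.
Proof.
move=> h; have h1 := ltnW h; have h2 : (i < j.+1)%N by apply/ltnW/leqW.
by rewrite /cartan (ltn_eqF h) (ltn_eqF h1) (ltn_eqF h2) mulr0 !subr0.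
Qed.

Lemma cartan_far_r i j : (j.+1 < i)%N -> cartan i j = 0.
Proof.
move=> h; have h1 := ltnW h; have h2 : (j < i.+1)%N by apply/ltnW/leqW.
by rewrite /cartan (gtn_eqF h) (gtn_eqF h1) (gtn_eqF h2) mulr0 !subr0.
Qed.

Lemma cartan_int i j : cartan i j \is a Num.int.
Proof. by rewrite /cartan !rpredB ?rpredM ?rpred_nat. Qed.

Lemma vacancy_int r l mu (m : 'M[nat]_(r, l)) a (i : 'I_l) :
  vacancy mu m a i \is a Num.int.
Proof.
rewrite /vacancy rpredB ?rpredM ?rpred_nat ?rpred_sum // => b _.
  by rewrite rpred_nat.
rewrite rpredM ?cartan_int // rpred_sum // => k _.
by rewrite rpredM ?rpred_nat.
Qed.

Lemma vacancy_nat n l mu (m : 'M[nat]_(n.-1, l)) a (i : 'I_l) :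
  F_index n l mu m -> (i.+1 < l)%N -> vacancy mu m a i \is a Num.nat.
Proof. by move=> [h _] il; rewrite natrEint vacancy_int h. Qed.

Lemma vacancy'E n l eta (m : 'M[nat]_(n.-1, l)) a (i : 'I_l) : F'_index n l eta m ->
  (i.+1 < l)%N ->
  vacancy' eta m a i = (multiplicity eta a.+1)%:R
    - \sum_(b < n.-1) cartan a.+1 b.+1 *
        \sum_(k < l) (minn i.+1 k.+1)%:R * (m b k)%:R.
Proof.
move=> [_ hW] il; have l0 : l%:R != 0 :> rat by rewrite pnatr_eq0; lia.
have E b : \sum_(k < l | (k.+1 < l)%N) cartan_inv l i.+1 k.+1 * (m b k)%:R
    = \sum_(k < l) (minn i.+1 k.+1)%:R * (m b k)%:R
      - i.+1%:R / l%:R * \sum_(c < n.-1) cartan_inv n b.+1 c.+1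
                  * (multiplicity eta c.+1)%:R.
  rewrite -hW mulr_sumr -sumrB big_mkcond; apply: eq_bigr => k _.
  rewrite /cartan_inv natrM; case: ifPn => kl; first by field.
  have -> : k.+1 = l by have := ltn_ord k; lia.
  have -> : minn i.+1 l = i.+1 by lia.
  by field.
rewrite /vacancy'; under eq_bigr do rewrite E mulrBr.
rewrite sumrB.
have -> : \sum_(b < n.-1) cartan a.+1 b.+1 * (i.+1%:R / l%:R *
     \sum_(c < n.-1) cartan_inv n b.+1 c.+1 * (multiplicity eta c.+1)%:R)
   = i.+1%:R / l%:R * (multiplicity eta a.+1)%:R.
  under eq_bigr do rewrite mulrCA mulr_sumr.
  rewrite -mulr_sumr exchange_big /=; congr (_ * _).
  under eq_bigr do (under eq_bigr do rewrite mulrA; rewrite -mulr_suml cartan_invP //).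
  rewrite (bigD1 a) //= eqxx mul1r big1 ?addr0 // => c ca.
  by rewrite (_ : (_ == _) = false) ?mul0r //; apply/negbTE; rewrite eq_sym.
rewrite /cartan_inv mul1n (_ : minn 1 i.+1 = 1%N); last by lia.
ring.
Qed.

Lemma vacancy'_nat n l eta (m : 'M[nat]_(n.-1, l)) a (i : 'I_l) :
  F'_index n l eta m -> (i.+1 < l)%N -> vacancy' eta m a i \is a Num.nat.
Proof.
move=> hm il; rewrite natrEint; case: (hm) => -> // _; rewrite andbT.
rewrite (vacancy'E a hm il) rpredB ?rpred_nat ?rpred_sum // => b _.
rewrite rpredM ?cartan_int // rpred_sum // => k _.
by rewrite rpredM ?rpred_nat.
Qed.

Lemma bin2_nat (z : rat) : z \is a Num.int -> z * (z - 1) / 2 \is a Num.nat.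
Proof.
have binE k : ('C(k.+1, 2))%:R = (k.+1%:R * k%:R) / 2 :> rat.
  have /(congr1 (fun x => x%:R : rat)) := mul_bin_diag k.+1 1.
  by rewrite bin1 !natrM => ->; field.
move=> /intrP[[[|k]|k] ->].
- by rewrite (_ : _ / 2 = 0) ?rpred0 //; field.
- rewrite (_ : _ / 2 = ('C(k.+1, 2))%:R) ?rpred_nat // binE.
  by rewrite -pmulrn -natr1; field.
- rewrite (_ : _ / 2 = ('C(k.+2, 2))%:R) ?rpred_nat // binE.
  by rewrite NegzE mulrNz -pmulrn -(natr1 k.+1); field.
Qed.

Lemma cartan_form (r : nat) (y : nat -> rat) :
  y 0%N * (y 0%N - 1) / 2
  + 2^-1 * \sum_(a < r) \sum_(b < r) cartan a.+1 b.+1 * (y a.+1 * y b.+1)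
  - \sum_(a < r | a == 0%N :> nat) y 0%N * y a.+1
  = \sum_(a < r) (y a - y a.+1) * (y a - y a.+1 - 1) / 2 + y r * (y r - 1) / 2.
Proof.
elim: r => [|r IH]; first by rewrite !big_ord0; ring.
rewrite [in RHS]big_ord_recr /=.
have -> : \sum_(a < r.+1) \sum_(b < r.+1) cartan a.+1 b.+1 * (y a.+1 * y b.+1)
  = \sum_(a < r) \sum_(b < r) cartan a.+1 b.+1 * (y a.+1 * y b.+1)
    + 2 * (y r.+1 * y r.+1) - 2 * (if r is 0 then 0 else y r * y r.+1).
  rewrite big_ord_recr /=; under eq_bigr do rewrite big_ord_recr /=.
  rewrite big_split /= big_ord_recr /=.
  have -> : \sum_(i < r) cartan r.+1 i.+1 * (y r.+1 * y i.+1)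
      = - (if r is 0 then 0 else y r * y r.+1).
    case: (r) => [|s]; first by rewrite big_ord0 oppr0.
    rewrite big_ord_recr big1 /= => [|i _]; last first.
      by rewrite cartan_far_r ?mul0r // !ltnS.
    by rewrite cartan_near_r; ring.
  have -> : \sum_(i < r) cartan i.+1 r.+1 * (y i.+1 * y r.+1)
      = - (if r is 0 then 0 else y r * y r.+1).
    case: (r) => [|s]; first by rewrite big_ord0 oppr0.
    rewrite big_ord_recr big1 /= => [|i _]; last first.
      by rewrite cartan_far_l ?mul0r // !ltnS.
    by rewrite cartan_near_l; ring.
  rewrite cartan_diag; case: (r) => [|s]; ring.
have -> : \sum_(a < r.+1 | a == 0%N :> nat) y 0%N * y a.+1
  = \sum_(a < r | a == 0%N :> nat) y 0%N * y a.+1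
    + (if r is 0 then y 0%N * y 1%N else 0).
  by rewrite big_mkcond big_ord_recr -big_mkcond /=; case: (r).
have {IH} : \sum_(a < r) (y a - y a.+1) * (y a - y a.+1 - 1) / 2
  = y 0%N * (y 0%N - 1) / 2
  + 2^-1 * \sum_(a < r) \sum_(b < r) cartan a.+1 b.+1 * (y a.+1 * y b.+1)
  - \sum_(a < r | a == 0%N :> nat) y 0%N * y a.+1 - y r * (y r - 1) / 2.
  by rewrite IH; ring.
by move=> ->; case: (r) => [|s]; field.
Qed.

Lemma sum_ltn l c : (\sum_(i < l) (i < c)%N)%N = minn l c.
Proof.
elim: l => [|l IH]; first by rewrite big_ord0 min0n.
by rewrite big_ord_recr /= IH; lia.
Qed.

Lemma minn_sum l j x : (j < l)%N ->
  (minn j.+1 x)%:R = \sum_(i < l) (i <= j)%N%:R * (i < x)%N%:R :> rat.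
Proof.
move=> jl; have <- : minn l (minn j.+1 x) = minn j.+1 x by lia.
rewrite -sum_ltn natr_sum; apply: eq_bigr => i _.
by rewrite -natrM mulnb leq_min ltnS.
Qed.

Lemma nstatE l mu : is_part mu -> (head 0%N mu <= l)%N ->
  nstat mu = (\sum_(i < l) 'C(conj_part mu i.+1, 2))%N.
Proof.
move=> /andP[smu _] hl; rewrite /nstat big_add1 /= -(subnKC hl).
rewrite big_split_ord /= [X in (_ + X)%N]big1 ?addn0 ?big_mkord // => i _.
suff -> : conj_part mu (head 0%N mu + i).+1 = 0%N by [].
move: (nat_of_ord i) => {hl}i; case: mu smu => [|x mu] // smu.
rewrite /conj_part; apply/eqP; rewrite -leqn0 leqNgt -has_count.
apply/hasPn => y; rewrite inE => /orP[/eqP ->|ymu] /=.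
  by rewrite -ltnNge ltnS leq_addr.
have /allP/(_ y ymu) : all (geq x) mu.
  apply: order_path_min smu => u v w /= vu uw; exact: leq_trans uw vu.
by rewrite /= -ltnNge ltnS => /leq_trans; apply; rewrite leq_addr.
Qed.

Lemma charge_nat r l mu (m : 'M[nat]_(r, l)) :
  is_part mu -> (head 0%N mu <= l)%N -> charge mu m \is a Num.nat.
Proof.
move=> pmu hl.
pose N (a : 'I_r) (i : 'I_l) : rat := \sum_(j < l) (i <= j)%N%:R * (m a j)%:R.
have [y [y0 yE yint]] : exists y : 'I_l -> nat -> rat,
    [/\ forall i, y i 0%N = (conj_part mu i.+1)%:R,
        forall i (a : 'I_r), y i a.+1 = N a i
      & forall i a, y i a \is a Num.int].
  exists (fun (i : 'I_l) a => if a is b.+1 then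
    if insub b is Some a' then N a' i else 0 else (conj_part mu i.+1)%:R).
  split=> // [i a|i [|a]]; rewrite ?valK ?rpred_nat //.
  case: insubP => [a' _ _|_]; rewrite ?rpred0 // rpred_sum // => j _.
  by rewrite rpredM ?rpred_nat.
have energyE : energy m = \sum_(i < l)
    2^-1 * \sum_(a < r) \sum_(b < r) cartan a.+1 b.+1 * (y i a.+1 * y i b.+1).
  rewrite /energy -[RHS]mulr_sumr; congr (_ * _).
  rewrite [RHS]exchange_big; apply: eq_bigr => a _ /=.
  rewrite [RHS]exchange_big; apply: eq_bigr => b _ /=.
  rewrite -[RHS]mulr_sumr; congr (_ * _).
  under eq_bigr do under eq_bigr do rewrite (minn_sum _ (ltn_ord _)) !mulr_suml.
  under [RHS]eq_bigr do rewrite !yE /N mulr_suml.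
  rewrite [RHS]exchange_big; apply: eq_bigr => j _ /=.
  under [RHS]eq_bigr do rewrite mulr_sumr.
  rewrite [RHS]exchange_big; apply: eq_bigr => k _ /=.
  by apply: eq_bigr => i _; rewrite ltnS; ring.
have linE : \sum_(x <- mu) \sum_(a < r | a == 0%N :> nat) \sum_(j < l)
      (minn j.+1 x)%:R * (m a j)%:R
    = \sum_(i < l) \sum_(a < r | a == 0%N :> nat) y i 0%N * y i a.+1.
  rewrite exchange_big [RHS]exchange_big; apply: eq_bigr => a _ /=.
  under [RHS]eq_bigr do rewrite y0 yE /N mulr_sumr.
  rewrite exchange_big [RHS]exchange_big; apply: eq_bigr => j _ /=.
  rewrite -[LHS]mulr_suml.
  under [X in X * _ = _]eq_bigr do rewrite (minn_sum _ (ltn_ord j)).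
  rewrite exchange_big mulr_suml; apply: eq_bigr => i _ /=.
  rewrite -mulr_sumr -natr_sum /conj_part -sumn_count sumnE big_map.
  by rewrite mulrAC mulrC.
have nE : (nstat mu)%:R = \sum_(i < l) y i 0%N * (y i 0%N - 1) / 2.
  rewrite (nstatE pmu hl) natr_sum; apply: eq_bigr => i _; rewrite y0.
  case: (conj_part _ _) => [|k]; first by rewrite !mul0r.
  have /(congr1 (fun x => x%:R : rat)) := mul_bin_diag k.+1 1.
  by rewrite bin1 /= !natrM -(natr1 k) addrK => ->; field.
rewrite /charge energyE linE nE -big_split /= -sumrB.
apply: rpred_sum => i _; rewrite cartan_form rpredD ?bin2_nat //.
by apply: rpred_sum => a _; rewrite bin2_nat ?rpredB.
Qed.

Lemma energy_nat r l (m : 'M[nat]_(r, l)) : energy m \is a Num.nat.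
Proof.
have := charge_nat (mu := [::]) m isT (leq0n _).
by rewrite /charge /nstat big_geq // big_nil add0r subr0.
Qed.

Lemma finite_index r l (W : 'I_r -> rat) (A : set 'M[nat]_(r, l)) :
  (forall m, A m -> forall a, \sum_(i < l) i.+1%:R * (m a i)%:R = W a) ->
  finite_set A.
Proof.
move=> hA; pose B := (\max_(a < r) Num.truncn (W a))%N.
pose f (M : 'M['I_B.+1]_(r, l)) : 'M[nat]_(r, l) := map_mx val M.
apply: (@sub_finite_set _ _ (f @` setT)); last exact: finite_image.
move=> m /hA hm; exists (\matrix_(a, i) inord (m a i)) => //.
apply/matrixP => a i; rewrite !mxE /= inordK // ltnS.
apply: leq_trans (leq_bigmax a).
have le : (m a i)%:R <= W a.
  rewrite -hm (bigD1 i) //= -natrM -[X in X <= _]addr0 lerD //.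
    by rewrite ler_nat mulSn leq_addr.
  by apply: sumr_ge0 => j _; rewrite mulr_ge0 ?ler0n.
by rewrite truncn_ge_nat // (le_trans _ le) ?ler0n.
Qed.

Lemma finite_F_index n l mu : finite_set (F_index n l mu).
Proof. by apply: finite_index => m [_ h]; exact: h. Qed.

Lemma finite_F'_index n l eta : finite_set (F'_index n l eta).
Proof. by apply: finite_index => m [_ h]; exact: h. Qed.

(* The exponent tL(L-n)/(2n) is an integer when n divides L. *)
Lemma shift_dvd n t L : (n %| L)%N ->
  ((2 * n)%N%:Z %| (t * L)%N%:Z * (L%:Z - n%:Z))%Z.
Proof.
move=> /dvdnP[k ->].
have : (2 %| k%:Z * (k%:Z - 1))%Z.
  case: k => [|k]; first by rewrite mul0r dvdz0.
  rewrite (_ : _ * _ = (k.+1 * k)%N%:Z); last first.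
    by rewrite PoszM -[k.+1 in X in _ * X]addn1 PoszD addrK.
  by rewrite dvdzE /= dvdn2 oddM /= andNb.
move=> /dvdzP[u hu]; apply/dvdzP; exists (t%:Z * n%:Z * u).
transitivity (t%:Z * n%:Z * n%:Z * (k%:Z * (k%:Z - 1))).
  by rewrite !PoszM; ring.
by rewrite hu PoszM; ring.
Qed.

(* Main.v *)
(* Write n = r + 1, l = t + d, L = n M.  The minimum of c_l is attained at the
   configuration m^(a)_i = (n-a) M delta_{it}, whose vacancy numbers all vanish.
   In terms of the tail sums N^(a)_i = \sum_{j >= i} m^(a)_j the quadratic form
   decouples as 1/2 \sum_i \sum_{a,b} C_ab N^(a)_i N^(b)_i, and the deviation of
   N from the dominant configuration splits at i = t: its entries beyond t are
   the tail sums of a configuration of F^(l-t)', and minus its entries up to t,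
   read backwards, those of a configuration of F^(t)'.  The exponents add, the
   vacancy numbers correspond, and the vacancy number at t is the common zeta.
   For large L every pair of configurations of bounded energy is reached, and
   the q-binomial at position t tends to 1 / (q)_zeta. *)
Require Import Defs.
From mathcomp Require Import all_boot all_order all_algebra.
From mathcomp Require Import zify ring.
From mathcomp Require Import boolp classical_sets functions cardinality fsbigop.

Set Implicit Arguments.
Unset Strict Implicit.
Unset Printing Implicit Defensive.

Import Order.TTheory GRing.Theory Num.Theory.
Local Open Scope ring_scope.

(** * Tail sums of a configuration and the energy as a quadratic form in them *)

Section Tails.

Variables r l : nat.
Implicit Types (m : 'M[nat]_(r, l)) (a : 'I_r) (i : nat).

Definition tail m a i : nat := \sum_(j < l | (i <= j)%N) m a j.

(** Inverse of [tail]: the truncated difference is exact for the decreasing f to which it is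
    applied. *)
Definition of_tail (f : 'I_r -> nat -> nat) : 'M[nat]_(r, l) :=
  \matrix_(a, i) (f a i - f a i.+1)%N.

(** Vacancy numbers become partial sums of these quantities over the levels i. *)
Definition ctail m a i : rat :=
  \sum_(b < r) cartan a.+1 b.+1 * (tail m b i)%:R.

Lemma tail_geq m a i : (l <= i)%N -> tail m a i = 0%N.
Proof.
move=> li; rewrite /tail big_pred0 // => j; apply/negbTE.
by rewrite -ltnNge (leq_trans (ltn_ord j)).
Qed.

Lemma tail_rec m a (i : 'I_l) : tail m a i = (m a i + tail m a i.+1)%N.
Proof.
rewrite /tail (bigD1 i) //=; congr (_ + _)%N; apply: eq_bigl => j.
by rewrite ltn_neqAle andbC eq_sym.
Qed.

Lemma tail_leq m a i j : (i <= j)%N -> (tail m a j <= tail m a i)%N.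
Proof.
move=> ij; rewrite /tail big_mkcond [X in (_ <= X)%N]big_mkcond leq_sum // => k _.
by case: (leqP j k) => // jk; rewrite (leq_trans ij jk).
Qed.

Lemma tail_of_tail (f : 'I_r -> nat -> nat) a i :
  (forall j, (f a j.+1 <= f a j)%N) -> f a l = 0%N -> (i <= l)%N ->
  tail (of_tail f) a i = f a i.
Proof.
move=> f_dec f0 il; have [s] := ubnP (l - i); elim: s i il => // s IH i il hs.
case: (ltngtP i l) il => // [il _|-> _]; last by rewrite tail_geq.
have -> : i = Ordinal il :> nat by [].
by rewrite tail_rec mxE /= IH //; [rewrite subnK | lia].
Qed.

Lemma tail_inj m m' :
  (forall a i, (i < l)%N -> tail m a i = tail m' a i) -> m = m'.
Proof.
move=> eq_t; apply/matrixP => a i; apply: (@addIn (tail m a i.+1)).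
rewrite -tail_rec eq_t // tail_rec; congr (_ + _)%N.
by case: (ltnP i.+1 l) => [/eq_t ->|li] //; rewrite !tail_geq.
Qed.

(** [minn x k.+1] counts the levels i < x with i <= k; exchanging the sums over k and i produces the
    tails. *)
Lemma sum_minn_tail m a x :
  \sum_(k < l) (minn x k.+1)%:R * (m a k)%:R
  = \sum_(i < x) (tail m a i)%:R :> rat.
Proof.
under [RHS]eq_bigr do rewrite /tail big_mkcond natr_sum.
rewrite exchange_big; apply: eq_bigr => k _ /=.
rewrite -sum_ltn natr_sum mulr_suml; apply: eq_bigr => i _.
by rewrite ltnS; case: ifP; rewrite ?mul1r ?mul0r.
Qed.

Lemma weight_tail m a :
  \sum_(k < l) k.+1%:R * (m a k)%:R = \sum_(i < l) (tail m a i)%:R :> rat.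
Proof.
rewrite -sum_minn_tail; apply: eq_bigr => k _.
by rewrite (minn_idPr (ltn_ord k)).
Qed.

Lemma sum_ctail m a x :
  \sum_(b < r) cartan a.+1 b.+1 * \sum_(i < x) (tail m b i)%:R
  = \sum_(i < x) ctail m a i.
Proof. by under eq_bigr do rewrite mulr_sumr; rewrite exchange_big. Qed.

(** Summing out k by [sum_minn_tail], then j over j >= i, replaces the kernel [minn] by a sum over
    levels that no longer interact. *)
Lemma energy_tail m :
  energy m = 2^-1 * \sum_(i < l) \sum_(a < r) (tail m a i)%:R * ctail m a i.
Proof.
rewrite /energy; congr (_ * _); rewrite [RHS]exchange_big; apply: eq_bigr => a _ /=.
under [RHS]eq_bigr do rewrite mulr_sumr.
rewrite [RHS]exchange_big; apply: eq_bigr => b _ /=.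
under [RHS]eq_bigr do rewrite mulrCA.
rewrite -[RHS]mulr_sumr; congr (_ * _).
have -> : \sum_(j < l) \sum_(k < l)
      (minn j.+1 k.+1)%:R * (m a j)%:R * (m b k)%:R
    = \sum_(j < l) \sum_(i < l | (i <= j)%N) (m a j)%:R * (tail m b i)%:R :> rat.
  apply: eq_bigr => j _; under eq_bigr do rewrite mulrAC mulrC.
  rewrite -!mulr_sumr sum_minn_tail; congr (_ * _).
  by rewrite (big_ord_widen l (fun i => (tail m b i)%:R : rat)).
rewrite (exchange_big_dep predT) //=; apply: eq_bigr => i _.
by rewrite -mulr_suml -natr_sum.
Qed.

(** By [cartan_form] the form at each level is a sum of terms z(z-1)/2, nonnegative on integers, and
    these dominate the increments of y. Bounded energy therefore bounds all tails and entries. *)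
Lemma tail_le_energy m a i : (tail m a i)%:R <= energy m.
Proof.
have [y [y0 yE yint]] : exists y : nat -> nat -> rat,
    [/\ forall j, y j 0%N = 0,
        forall j (b : 'I_r), y j b.+1 = (tail m b j)%:R
      & forall j b, y j b \is a Num.int].
  (* Row a sits at index a + 1, with boundary value 0 at index 0, to fit the shape of
     [cartan_form]. *)
  exists (fun j b => if b is c.+1 then
    if insub c is Some b' then (tail m b' j)%:R else 0 else 0).
  split=> // [j b|j [|b]]; rewrite ?valK ?rpred_nat //.
  by case: insubP => [b' _ _|_]; rewrite ?rpred_nat ?rpred0.
pose Q j := \sum_(b < r) (tail m b j)%:R * ctail m b j.
have QE j : 2^-1 * Q j = \sum_(b < r) (y j b - y j b.+1) * (y j b - y j b.+1 - 1) / 2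
    + y j r * (y j r - 1) / 2.
  have lin0 : \sum_(b < r | b == 0%N :> nat) y j 0%N * y j b.+1 = 0.
    by rewrite big1 // => b _; rewrite y0 mul0r.
  rewrite -cartan_form lin0 y0 !mul0r add0r subr0.
  congr (_ * _); apply: eq_bigr => b _; rewrite mulr_sumr; apply: eq_bigr => c _.
  by rewrite !yE; ring.
have half_ge0 (z : rat) : z \is a Num.int -> 0 <= z * (z - 1) / 2.
  by move=> /bin2_nat; rewrite natrEint => /andP[].
have Q_ge0 j : 0 <= 2^-1 * Q j.
  by rewrite QE addr_ge0 ?half_ge0 ?sumr_ge0 // => b _; rewrite half_ge0 ?rpredB.
case: (ltnP i l) => [il|li]; last first.
  by rewrite tail_geq //; move: (energy_nat m); rewrite natrEint => /andP[].
rewrite energy_tail mulr_sumr (bigD1 (Ordinal il)) //=.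
apply: (@le_trans _ _ (2^-1 * Q i)); last first.
  by rewrite lerDl sumr_ge0 // => j _; apply: Q_ge0.
rewrite QE -yE.
(* Telescoping: each increment of y is at most the binomial of its opposite. *)
have step (z : rat) : z \is a Num.int -> - z <= z * (z - 1) / 2.
  move=> zi; rewrite -subr_ge0 (_ : _ - - z = - z * (- z - 1) / 2); last by field.
  by rewrite half_ge0 ?rpredN.
have tele b : (b <= r)%N ->
    y i b <= \sum_(c < b) (y i c - y i c.+1) * (y i c - y i c.+1 - 1) / 2.
  elim: b => [|b IH] br; first by rewrite big_ord0 y0.
  rewrite big_ord_recr /= -[X in X <= _](subrK (y i b)) addrC lerD ?IH ?(ltnW br) //.
  by rewrite -opprB step ?rpredB.
apply: le_trans (tele _ (ltn_ord a)) _.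
rewrite (big_ord_widen r
  (fun c => (y i c - y i c.+1) * (y i c - y i c.+1 - 1) / 2) (ltn_ord a)).
rewrite -[X in X <= _]addr0 lerD ?half_ge0 // big_mkcond /=.
by apply: ler_sum => c _; case: ifP => // _; rewrite half_ge0 ?rpredB.
Qed.

End Tails.

(** * Inversion of the Cartan matrix; index sets and vacancy numbers in terms of tails *)

Lemma cartan_inv_cartan n a c : (a < n.-1)%N -> (c < n.-1)%N ->
  \sum_(b < n.-1) cartan_inv n a.+1 b.+1 * cartan b.+1 c.+1 = (a == c)%:R.
Proof.
move=> ha hc.
pose A : 'M[rat]_n.-1 := \matrix_(i, j) cartan i.+1 j.+1.
pose B : 'M[rat]_n.-1 := \matrix_(i, j) cartan_inv n i.+1 j.+1.
(* A right inverse of a square matrix is also a left inverse. *)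
have /mulmx1C/matrixP/(_ (Ordinal ha) (Ordinal hc)) : A *m B = 1%:M.
  apply/matrixP => i j; rewrite !mxE.
  by under eq_bigr do rewrite !mxE; rewrite cartan_invP.
by rewrite !mxE => <-; apply: eq_bigr => b _; rewrite !mxE.
Qed.

Lemma cartan_solve n (z w : 'I_n.-1 -> rat) :
  (forall a, z a = \sum_(b < n.-1) cartan a.+1 b.+1 * w b) <->
  (forall a, w a = \sum_(b < n.-1) cartan_inv n a.+1 b.+1 * z b).
Proof.
have sub (A B : nat -> nat -> rat) (x y : 'I_n.-1 -> rat) :
    (forall a c, (a < n.-1)%N -> (c < n.-1)%N ->
       \sum_(b < n.-1) B a.+1 b.+1 * A b.+1 c.+1 = (a == c)%:R) ->
    (forall a, x a = \sum_(b < n.-1) A a.+1 b.+1 * y b) ->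
    forall a, y a = \sum_(b < n.-1) B a.+1 b.+1 * x b.
  move=> BA xE a; under eq_bigr do rewrite xE mulr_sumr.
  rewrite exchange_big /=.
  under eq_bigr do (under eq_bigr do rewrite mulrA; rewrite -mulr_suml BA //).
  rewrite (bigD1 a) //= eqxx mul1r big1 ?addr0 // => b ba.
  by rewrite (_ : _ == _ = false) ?mul0r //; apply/negbTE; rewrite eq_sym.
by split; apply: sub => a c; [exact: cartan_inv_cartan | exact: cartan_invP].
Qed.

(** The larger of a and c is at most n, so ac <= n min(a,c). This makes the inverse Cartan matrix
    order preserving, as [split_exists] needs. *)
Lemma cartan_inv_ge0 n a c : (a <= n)%N -> (c <= n)%N -> 0 <= cartan_inv n a c.
Proof.
case: n => [|n] an cn; first by rewrite /cartan_inv invr0 mulr0 subr0 ler0n.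
rewrite subr_ge0 ler_pdivrMr ?ltr0n // -natrM ler_nat.
by case: (leqP a c) => _; rewrite ?leq_mul2l ?(mulnC a) ?leq_mul2l ?an ?cn orbT.
Qed.

Lemma sum_nseq (f : nat -> rat) L t : \sum_(x <- nseq L t) f x = L%:R * f t.
Proof.
elim: L => [|L IH]; first by rewrite big_nil mul0r.
by rewrite big_cons IH -natr1; ring.
Qed.

(** The rank-one parts -ik/l of the inverse matrix add up to a multiple of the total weight, whose
    Cartan image is zeta; this cancels the -i/l in the coefficient of zeta. *)
Lemma vacancy'_tail r l eta (m : 'M[nat]_(r, l)) (a : 'I_r) (i : 'I_l) :
  (multiplicity eta a.+1)%:R = \sum_(k < l) ctail m a k ->
  vacancy' eta m a i
  = (multiplicity eta a.+1)%:R - \sum_(k < i.+1) ctail m a k.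
Proof.
move=> zE; have l0 : l%:R != 0 :> rat by rewrite pnatr_eq0; case: (l) i => [[]|].
rewrite /vacancy' /cartan_inv mul1n (_ : minn 1 i.+1 = 1%N); last by lia.
have E b : \sum_(k < l | (k.+1 < l)%N)
      ((minn i.+1 k.+1)%:R - (i.+1 * k.+1)%N%:R / l%:R) * (m b k)%:R
    = \sum_(k < i.+1) (tail m b k)%:R
      - i.+1%:R / l%:R * \sum_(k < l) (tail m b k)%:R :> rat.
  rewrite -sum_minn_tail -weight_tail mulr_sumr -sumrB big_mkcond.
  (* The omitted index k + 1 = l has coefficient min(i+1,l) - (i+1) = 0, so the sum may run over all
     columns. *)
  apply: eq_bigr => k _; rewrite natrM; case: ifPn => kl; first by field.
  have kE : k.+1 = l by have := ltn_ord k; lia.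
  by rewrite kE (minn_idPl (ltn_ord i)); field.
under eq_bigr do rewrite E mulrBr mulrCA.
rewrite sumrB -mulr_sumr !sum_ctail -zE.
by rewrite mulrBl mul1r; ring.
Qed.

(** The Cartan matrix is applied to the weight condition, turning it into a formula for zeta; the
    remaining inequalities say that partial sums of [ctail] do not exceed their total. *)
Lemma F'_indexP n l eta (m : 'M[nat]_(n.-1, l)) :
  F'_index n l eta m <->
  (forall a : 'I_n.-1, (multiplicity eta a.+1)%:R = \sum_(k < l) ctail m a k) /\
  (forall (a : 'I_n.-1) i, (i.+1 < l)%N ->
     \sum_(k < i.+1) ctail m a k <= (multiplicity eta a.+1)%:R).
Proof.
have weightP : (forall a : 'I_n.-1,
      (multiplicity eta a.+1)%:R = \sum_(k < l) ctail m a k) <->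
    (forall a : 'I_n.-1, \sum_(i < l) i.+1%:R * (m a i)%:R
      = \sum_(b < n.-1) cartan_inv n a.+1 b.+1 * (multiplicity eta b.+1)%:R :> rat).
  under eq_forall do rewrite -sum_ctail.
  under [X in _ <-> X]eq_forall do rewrite weight_tail.
  exact: cartan_solve.
split=> [[vac /weightP zE]|[zE vac]]; split=> //.
- move=> a i il; rewrite -subr_ge0.
  by rewrite -(vacancy'_tail (Ordinal (ltnW il)) (zE a)) vac.
- by move=> a i il; rewrite vacancy'_tail // subr_ge0 vac.
- exact/weightP.
Qed.

Lemma vacancy_tail r l L t (m : 'M[nat]_(r, l)) (a : 'I_r) (i : 'I_l) :
  vacancy (nseq L t) m a i
  = \sum_(k < i.+1) ((a == 0%N :> nat)%:R * L%:R * (k < t)%N%:R - ctail m a k).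
Proof.
rewrite /vacancy sum_nseq sumrB -mulr_sumr eqSS mulrA; congr (_ * _ - _).
  by rewrite -sum_ltn natr_sum.
by rewrite -sum_ctail; apply: eq_bigr => b _; rewrite sum_minn_tail.
Qed.

(* The tail sums of the dominant configuration, m^(a)_t = (n-a)L/n and 0
   elsewhere, where n = r + 1 and L = n M. *)
Definition ground r M (a : 'I_r) : nat := ((r - a) * M)%N.

Lemma groundE r M (a : 'I_r) :
  (ground M a)%:R = cartan_inv r.+1 a.+1 1 * (r.+1 * M)%N%:R.
Proof.
rewrite /ground /cartan_inv (_ : minn a.+1 1 = 1%N) ?muln1; last by lia.
rewrite !natrM natrB ?(ltnW (ltn_ord a)) // -!natr1.
by field; rewrite natr1 pnatr_eq0.
Qed.

(** The ground tails are L times the first column of the inverse Cartan matrix, so on the first t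
    levels they cancel the source term of the vacancy numbers. *)
Lemma cartan_ground r M (a : 'I_r) :
  \sum_(b < r) cartan a.+1 b.+1 * (ground M b)%:R
  = (a == 0%N :> nat)%:R * (r.+1 * M)%N%:R.
Proof.
have r0 : (0 < r)%N by case: (r) a => [[]|].
under eq_bigr do rewrite groundE mulrA.
by rewrite -mulr_suml (@cartan_invP r.+1 a 0).
Qed.

(* Tail sums of the deviation m - ground are read off from m1 beyond position
   t and, reflected, from m2 up to position t. *)
Definition glued r t d M (m : 'M[nat]_(r, t + d))
    (m1 : 'M[nat]_(r, d)) (m2 : 'M[nat]_(r, t)) : Prop :=
  (forall a i, (i < d)%N -> tail m a (t + i) = tail m1 a i) /\
  (forall a i, (i < t)%N -> (tail m a i + tail m2 a (t.-1 - i))%N = ground M a).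

(** * Levelwise effect of gluing on tails, partial sums and weights *)

Section Glued.

Variables (r t d M : nat) (m : 'M[nat]_(r, t + d)).
Variables (m1 : 'M[nat]_(r, d)) (m2 : 'M[nat]_(r, t)).
Hypothesis (gm : glued M m m1 m2).

Let L := (r.+1 * M)%N.

Lemma tail_glued2 (a : 'I_r) i : (i < t)%N ->
  (tail m a i)%:R = (ground M a)%:R - (tail m2 a (t.-1 - i))%:R :> rat.
Proof. by case: gm => _ g2 it; rewrite -(g2 a i it) natrD addrK. Qed.

Lemma ctail_glued1 (a : 'I_r) i : (i < d)%N -> ctail m a (t + i) = ctail m1 a i.
Proof. by case: gm => g1 _ id; apply: eq_bigr => b _; rewrite g1. Qed.

Lemma ctail_glued2 (a : 'I_r) i : (i < t)%N ->
  (a == 0%N :> nat)%:R * L%:R - ctail m a i = ctail m2 a (t.-1 - i).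
Proof.
move=> it; rewrite -cartan_ground -sumrB; apply: eq_bigr => b _.
by rewrite tail_glued2 //; ring.
Qed.

(** The reflection makes the first x levels of m the last x levels of m2, hence a total minus a
    partial sum. *)
Lemma sum_glued_low (a : 'I_r) x : (x <= t)%N ->
  \sum_(k < x) ((a == 0%N :> nat)%:R * L%:R * (k < t)%N%:R - ctail m a k)
  = \sum_(k < t) ctail m2 a k - \sum_(k < t - x) ctail m2 a k.
Proof.
elim: x => [|x IH] xt; first by rewrite big_ord0 subn0 subrr.
rewrite big_ord_recr /= IH ?(ltnW xt) // xt mulr1 ctail_glued2 //.
rewrite -(subnSK xt) big_ord_recr /= (_ : t.-1 - x = t - x.+1)%N; last by lia.
by rewrite opprD addrA subrK.
Qed.

(** Up to level t the sum is the full total for m2, the future zeta; beyond it the source has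
    stopped and only m1 is subtracted. *)
Lemma sum_glued_high (a : 'I_r) y : (y <= d)%N ->
  \sum_(k < t + y) ((a == 0%N :> nat)%:R * L%:R * (k < t)%N%:R - ctail m a k)
  = \sum_(k < t) ctail m2 a k - \sum_(k < y) ctail m1 a k.
Proof.
elim: y => [|y IH] yd.
  by rewrite addn0 sum_glued_low // subnn !big_ord0.
rewrite addnS big_ord_recr /= IH ?(ltnW yd) // big_ord_recr /=.
have -> : (t + y < t)%N = false by lia.
by rewrite ctail_glued1 // mulr0 sub0r opprD addrA.
Qed.

Lemma weight_glued (a : 'I_r) : \sum_(k < t + d) (tail m a k)%:R
  = t%:R * (ground M a)%:R - \sum_(k < t) (tail m2 a k)%:R
    + \sum_(k < d) (tail m1 a k)%:R :> rat.
Proof.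
rewrite big_split_ord /=; congr (_ + _); last first.
  by apply: eq_bigr => k _; case: gm => ->.
rewrite [in RHS](reindex_inj rev_ord_inj) /=.
under eq_bigr do rewrite tail_glued2 //.
rewrite sumrB sumr_const card_ord -[_ *+ t]mulr_natl; congr (_ - _).
by apply: eq_bigr => k _; congr ((tail m2 a _)%:R); lia.
Qed.

End Glued.

Lemma nstat_nseq L t : nstat (nseq L t) = (t * 'C(L, 2))%N.
Proof.
case: L => [|L]; first by rewrite /nstat big_geq // bin_small // muln0.
rewrite /nstat [head _ _]/= big_add1 /= big_mkord -[in RHS](card_ord t) -sum_nat_const.
by apply: eq_bigr => i _; rewrite /conj_part count_nseq /= ltn_ord mul1n.
Qed.

Lemma bin2_rat L : ('C(L, 2))%:R = L%:R * (L%:R - 1) / 2 :> rat.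
Proof.
case: L => [|L]; first by rewrite !mul0r.
have /(congr1 (fun x => x%:R : rat)) := mul_bin_diag L.+1 1.
by rewrite bin1 /= !natrM -(natr1 L) addrK => ->; field.
Qed.

Lemma sum_ground0 r M :
  \sum_(a < r) (a == 0%N :> nat)%:R * (ground M a)%:R = (r * M)%N%:R :> rat.
Proof.
case: r => [|r]; first by rewrite big_ord0.
by rewrite big_ord_recl big1 ?addr0 ?mul1r /ground ?subn0 // => i _; rewrite mul0r.
Qed.

Lemma cartanC i j : cartan i j = cartan j i.
Proof.
by rewrite /cartan (eq_sym j i) (eq_sym j i.+1) (eq_sym j.+1 i) addrAC.
Qed.

(** * Index conditions, entries and exponents under gluing *)

Section GluedIndex.

Variables (r t d M : nat) (m : 'M[nat]_(r, t + d)).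
Variables (m1 : 'M[nat]_(r, d)) (m2 : 'M[nat]_(r, t)).
Hypotheses (t_gt0 : (0 < t)%N) (d_gt0 : (0 < d)%N) (gm : glued M m m1 m2).

Let L := (r.+1 * M)%N.

(** The dominant configuration already has the prescribed weight, so the weight condition on m says
    that m1 and m2 have equal weights. *)
Lemma weight_F_index (a : 'I_r) :
  (r.+1 - a.+1)%N%:R / r.+1%:R * (sumn (nseq L t))%:R
  = t%:R * (ground M a)%:R :> rat.
Proof.
have r0 : r.+1%:R != 0 :> rat by rewrite pnatr_eq0.
rewrite sumn_nseq /ground /L subSS !natrM.
by field; rewrite nat1r.
Qed.

Lemma glued_F_index eta : F'_index r.+1 d eta m1 -> F'_index r.+1 t eta m2 ->
  F_index r.+1 (t + d) (nseq L t) m.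
Proof.
move=> im1 im2; have /F'_indexP[z1 p1] := im1; have /F'_indexP[z2 p2] := im2.
split=> [a i il|a].
  rewrite vacancy_tail; case: (leqP i.+1 t) => [it|ti].
    rewrite (sum_glued_low gm) // -z2; case: (posnP (t - i.+1)) => [->|xt].
      by rewrite big_ord0 subr0 ler0n.
    by rewrite subr_ge0 -(prednK xt) p2 //; lia.
  rewrite -(subnKC (ltnW ti)) (sum_glued_high gm) -?z2; last by lia.
  by rewrite subr_ge0 subSn // p1 //; lia.
rewrite weight_tail (weight_glued gm) weight_F_index.
case: im1 im2 => _ /(_ a) w1 [_ /(_ a) w2].
by rewrite -!weight_tail w1 w2 subrK.
Qed.

(** Equal weights have equal Cartan images, so the eta read off from m2 also fits m1. *)
Lemma F_index_glued eta : F_index r.+1 (t + d) (nseq L t) m ->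
  (forall a : 'I_r, (multiplicity eta a.+1)%:R = \sum_(k < t) ctail m2 a k) ->
  F'_index r.+1 d eta m1 /\ F'_index r.+1 t eta m2.
Proof.
move=> [vac wt] z2.
have {}wt a : \sum_(k < t) (tail m2 a k)%:R = \sum_(k < d) (tail m1 a k)%:R :> rat.
  have := wt a; rewrite weight_tail (weight_glued gm) weight_F_index => wE.
  by apply: (addrI (t%:R * (ground M a)%:R - \sum_(k < t) (tail m2 a k)%:R)); rewrite wE subrK.
have z1 (a : 'I_r) : (multiplicity eta a.+1)%:R = \sum_(k < d) ctail m1 a k.
  by rewrite z2 -!sum_ctail; apply: eq_bigr => b _; rewrite wt.
split; apply/F'_indexP; split=> // a i il.
  have hi : (t + i < t + d)%N by lia.
  have := vac a (Ordinal hi) ltac:(rewrite /=; lia).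
  by rewrite vacancy_tail /= -addnS (sum_glued_high gm) -?z2 ?subr_ge0 //; lia.
have hi : (t - i.+2 < t + d)%N by lia.
have := vac a (Ordinal hi) ltac:(rewrite /=; lia).
rewrite vacancy_tail /= (sum_glued_low gm) -?z2; last by lia.
by rewrite (_ : t - (t - i.+2).+1 = i.+1)%N ?subr_ge0 //; lia.
Qed.

(** This total is the vacancy number of m at position t, which is an admissible position because d >
    0. *)
Lemma sum_ctail_nat a : F_index r.+1 (t + d) (nseq L t) m ->
  \sum_(k < t) ctail m2 a k \is a Num.nat.
Proof.
move=> im; have ht : (t.-1 < t + d)%N by lia.
have := vacancy_nat (n := r.+1) (i := Ordinal ht) a im ltac:(rewrite /=; lia).
by rewrite vacancy_tail /= prednK // (sum_glued_low gm) // subnn big_ord0 subr0.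
Qed.

Lemma glued_entry_high a (i : 'I_d) : m a (rshift t i) = m1 a i.
Proof.
case: gm => g1 _; apply: (@addIn (tail m1 a i.+1)).
have /= m_rec := tail_rec m a (rshift t i).
rewrite -tail_rec -(g1 a i) // m_rec -addnS; congr (_ + _)%N.
by case: (ltnP i.+1 d) => [/g1 ->|di] //; rewrite !tail_geq // leq_add2l.
Qed.

Lemma glued_entry_low a (i : 'I_t) (j : 'I_t) : (i.+1 + j = t.-1)%N ->
  m a (lshift d i) = m2 a j.
Proof.
move=> ij; case: gm => _ g2.
have /= m_rec := tail_rec m a (lshift d i); have m2_rec := tail_rec m2 a j.
have := g2 a i ltac:(lia); have := g2 a i.+1 ltac:(lia).
rewrite (_ : t.-1 - i.+1 = j)%N; last by lia.
rewrite (_ : t.-1 - i = j.+1)%N; lia.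
Qed.

(** At the junction the tail drops from ground minus the top tail of m2 to the top tail of m1. This
    is the only entry that grows with M. *)
Lemma glued_entry_mid a (i : 'I_t) : i = t.-1 :> nat ->
  m a (lshift d i) = (ground M a - (tail m1 a 0 + tail m2 a 0))%N.
Proof.
move=> it; case: gm => g1 g2.
have /= m_rec := tail_rec m a (lshift d i).
have := g2 a t.-1 ltac:(lia); have := g1 a 0%N d_gt0.
have iS : i.+1 = t by lia.
by rewrite subnn addn0 -it; rewrite iS in m_rec; lia.
Qed.

(** The tail is ground minus w. The cross term of the quadratic form is L times the first component
    of w and cancels the w-part of the linear term, leaving the form in w and a constant. *)
Lemma form_glued i : (i < t)%N ->
  2^-1 * (\sum_(a < r) (tail m a i)%:R * ctail m a i)
    - L%:R * \sum_(a < r) (a == 0%N :> nat)%:R * (tail m a i)%:R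
  = 2^-1 * (\sum_(a < r) (tail m2 a (t.-1 - i))%:R * ctail m2 a (t.-1 - i))
    - 2^-1 * L%:R * (r * M)%N%:R.
Proof.
move=> it; set w := fun a : 'I_r => (tail m2 a (t.-1 - i))%:R : rat.
(* By symmetry the Cartan matrix is moved onto [ground], where [cartan_ground] evaluates it. *)
have cross : \sum_(a < r) (ground M a)%:R * ctail m2 a (t.-1 - i)
    = L%:R * \sum_(a < r) (a == 0%N :> nat)%:R * w a.
  under eq_bigr do rewrite mulr_sumr.
  rewrite exchange_big mulr_sumr; apply: eq_bigr => b _ /=.
  rewrite mulrA (mulrC L%:R) -cartan_ground mulr_suml; apply: eq_bigr => a _.
  by rewrite cartanC /w; ring.
have -> : \sum_(a < r) (tail m a i)%:R * ctail m a i
    = L%:R * (r * M)%N%:R - \sum_(a < r) (ground M a)%:R * ctail m2 a (t.-1 - i)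
      - L%:R * (\sum_(a < r) (a == 0%N :> nat)%:R * w a)
      + \sum_(a < r) w a * ctail m2 a (t.-1 - i).
  rewrite -(sum_ground0 r M) !mulr_sumr -!sumrB -big_split.
  apply: eq_bigr => a _ /=.
  by rewrite (tail_glued2 gm) // -(ctail_glued2 gm) // /w /L; ring.
have -> : \sum_(a < r) (a == 0%N :> nat)%:R * (tail m a i)%:R
    = (r * M)%N%:R - \sum_(a < r) (a == 0%N :> nat)%:R * w a.
  rewrite -(sum_ground0 r M) -sumrB; apply: eq_bigr => a _.
  by rewrite (tail_glued2 gm) // -mulrBr.
by rewrite cross; field.
Qed.

Lemma charge_glued : charge (nseq L t) m
  = (t * L)%N%:R * (L%:R - r.+1%:R) / (2 * r.+1)%N%:R + energy m1 + energy m2.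
Proof.
have linE : \sum_(a < r | a == 0%N :> nat) \sum_(j < t + d)
      (minn j.+1 t)%:R * (m a j)%:R
    = \sum_(i < t) \sum_(a < r) (a == 0%N :> nat)%:R * (tail m a i)%:R :> rat.
  rewrite [RHS]exchange_big big_mkcond; apply: eq_bigr => a _ /=.
  under eq_bigr do rewrite minnC.
  by rewrite sum_minn_tail -mulr_sumr; case: eqP; rewrite ?mul1r ?mul0r.
have e2E : energy m2 = \sum_(i < t)
    2^-1 * (\sum_(a < r) (tail m2 a (t.-1 - i))%:R * ctail m2 a (t.-1 - i)).
  rewrite energy_tail mulr_sumr (reindex_inj rev_ord_inj); apply: eq_bigr => i _ /=.
  by rewrite (_ : t - i.+1 = t.-1 - i)%N //; lia.
rewrite /charge nstat_nseq sum_nseq linE natrM bin2_rat energy_tail big_split_ord /=.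
have -> : \sum_(i < d) \sum_(a < r) (tail m a (t + i))%:R * ctail m a (t + i)
    = \sum_(i < d) \sum_(a < r) (tail m1 a i)%:R * ctail m1 a i.
  apply: eq_bigr => i _; apply: eq_bigr => a _.
  by rewrite (ctail_glued1 gm) //; case: gm => ->.
rewrite [2^-1 * (_ + _)]mulrDr -energy_tail [2^-1 * _]mulr_sumr.
have formE : \sum_(i < t) 2^-1 * (\sum_(a < r) (tail m a i)%:R * ctail m a i)
    = energy m2 - t%:R * (2^-1 * L%:R * (r * M)%N%:R)
      + L%:R * \sum_(i < t) \sum_(a < r) (a == 0%N :> nat)%:R * (tail m a i)%:R.
  rewrite e2E mulr_natl -[in X in _ - X + _](card_ord t) -sumr_const -sumrB mulr_sumr -big_split.
  by apply: eq_bigr => i _ /=; rewrite -form_glued // subrK.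
(* The constants tL(L-1)/2 from [nstat] and -tLrM/2 from the t levels combine to tL(L-n)/(2n), as L
   = nM and r = n - 1. *)
rewrite formE !natrM -[r.+1%:R]natr1.
by field; rewrite natr1 pnatr_eq0.
Qed.

End GluedIndex.

(** * Existence and uniqueness of gluing and splitting *)

Lemma glued_uniq_split r t d M (m : 'M[nat]_(r, t + d)) m1 m2 m1' m2' :
  glued M m m1 m2 -> glued M m m1' m2' -> m1 = m1' /\ m2 = m2'.
Proof.
move=> [g1 g2] [g1' g2']; split; apply: tail_inj => a i il.
  by rewrite -g1 ?g1'.
have it : (t.-1 - i < t)%N by lia.
have iE : (t.-1 - (t.-1 - i) = i)%N by lia.
by have := g2 a _ it; rewrite -(g2' a _ it) iE => /addnI.
Qed.

Lemma glued_uniq r t d M (m m' : 'M[nat]_(r, t + d)) m1 m2 :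
  glued M m m1 m2 -> glued M m' m1 m2 -> m = m'.
Proof.
move=> [g1 g2] [g1' g2']; apply: tail_inj => a i il.
case: (ltnP i t) => [it|ti].
  by have := g2 a _ it; rewrite -(g2' a _ it) => /addIn.
by rewrite -(subnKC ti) g1 ?g1' //; lia.
Qed.

(** Tails decrease within each half automatically; the hypothesis is what makes them decrease across
    the junction. *)
Lemma glued_exists r t d M (m1 : 'M[nat]_(r, d)) (m2 : 'M[nat]_(r, t)) :
  (0 < d)%N ->
  (forall a : 'I_r, tail m1 a 0 + tail m2 a 0 <= ground M a)%N ->
  exists m : 'M[nat]_(r, t + d), glued M m m1 m2.
Proof.
move=> d0 gap.
pose f a i := (if i < t then ground M a - tail m2 a (t.-1 - i) else tail m1 a (i - t))%N.
have f_dec a i : (f a i.+1 <= f a i)%N.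
  rewrite /f; case: (ltngtP i.+1 t) => it.
  - by rewrite leq_sub2l // tail_leq //; lia.
  - by rewrite tail_leq // leq_sub2r.
  - have -> : (i.+1 - t = 0)%N by lia.
    have -> : (t.-1 - i = 0)%N by lia.
    by have := gap a; lia.
have fl a : f a (t + d)%N = 0%N.
  by rewrite /f ltnNge leq_addr /= tail_geq // addKn.
exists (of_tail (t + d) f); split=> a i il; rewrite tail_of_tail //; try lia.
  by rewrite /f ltnNge leq_addr /= addKn.
by rewrite /f il subnK //; have := gap a; have := tail_leq m2 a (leq0n (t.-1 - i)); lia.
Qed.

Lemma split_exists r t d M (m : 'M[nat]_(r, t + d)) :
  (0 < t)%N -> (0 < d)%N -> F_index r.+1 (t + d) (nseq (r.+1 * M) t) m ->
  exists (m1 : 'M[nat]_(r, d)) (m2 : 'M[nat]_(r, t)), glued M m m1 m2.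
Proof.
move=> t0 d0 [vac _].
have tail0 (a : 'I_r) : (tail m a 0 <= ground M a)%N.
  (* [z] is the vacancy number at position 1, hence nonnegative; the nonnegative inverse Cartan
     matrix carries this over to ground minus tail. *)
  pose z (b : 'I_r) := \sum_(c < r) cartan b.+1 c.+1 * ((ground M c)%:R - (tail m c 0)%:R).
  have z_ge0 b : 0 <= z b.
    have h0 : (0 < t + d)%N by lia.
    have := vac b (Ordinal h0) ltac:(rewrite /=; lia).
    rewrite vacancy_tail /= big_ord1 t0 mulr1 -cartan_ground -sumrB.
    by under eq_bigr do rewrite -mulrBr.
  have /(@cartan_solve r.+1 z) := fun b => erefl (z b).
  move=> /(_ a) e; rewrite -(ler_nat rat) -subr_ge0 e sumr_ge0 // => b _.
  by rewrite mulr_ge0 ?cartan_inv_ge0 // ltnS ltnW.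
pose f1 a i := tail m a (t + i).
pose f2 a i := (if i < t then ground M a - tail m a (t.-1 - i) else 0)%N.
exists (of_tail d f1), (of_tail t f2); split=> a i il; rewrite tail_of_tail //; try lia.
- by move=> j; rewrite /f1 tail_leq //; lia.
- by rewrite /f1 tail_geq.
- rewrite /f2 (_ : t.-1 - i < t)%N; last by lia.
  rewrite (_ : t.-1 - (t.-1 - i) = i)%N; last by lia.
  by rewrite subnKC // (leq_trans _ (tail0 a)) // tail_leq.
- move=> j; rewrite /f2; case: ltnP => // jt; rewrite (ltnW jt) leq_sub2l // tail_leq //; lia.
- by rewrite /f2 ltnn.
Qed.

(** * Congruences modulo powers of q for q-binomials and quotients *)

Lemma qpochD_modX z M :
  exists p : {poly rat}, qpoch (z + M) = qpoch M * (1 + 'X^(M.+1) * p).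
Proof.
elim: z => [|z [p IH]]; first by exists 0; rewrite mulr0 addr0 mulr1.
exists (p - 'X^z * (1 + 'X^(M.+1) * p)).
rewrite addSn qpochS IH -mulrA; congr (_ * _).
by rewrite -addnS exprD; ring.
Qed.

Lemma qbin_modX z M :
  exists p : {poly rat}, qbin (z + M) M * qpoch z = 1 + 'X^(M.+1) * p.
Proof.
have [p pE] := qpochD_modX z M; exists p; apply: (mulfI (qpoch_neq0 M)).
by rewrite -pE -(qbinE (leq_addl z M)) addnK; ring.
Qed.

Lemma prod_qbin_modX r k (z g : 'I_r -> nat) : (forall a, k <= g a)%N ->
  exists p : {poly rat}, (\prod_a qbin (z a + g a) (g a)) * (\prod_a qpoch (z a))
    = 1 + 'X^(k.+1) * p.
Proof.
move=> kg; rewrite -big_split /=.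
elim/big_ind: _ => [|_ _ [p ->] [q ->]|a _].
- by exists 0; rewrite mulr0 addr0.
- by exists (p + q + 'X^(k.+1) * p * q); ring.
have [p ->] := qbin_modX (z a) (g a); exists ('X^(g a - k) * p).
by rewrite mulrA -exprD addSn subnKC.
Qed.

(** R and the truncated geometric sum both invert Q modulo q^(k+1), so they give the same
    coefficient k. *)
Lemma quo_series_modX (P Q R p : {poly rat}) k : Q`_0 = 1 ->
  R * Q = 1 + 'X^(k.+1) * p -> quo_series P Q k = (P * R)`_k.
Proof.
move=> Q0 RQ; rewrite /quo_series; set G := \sum_(i < _) _.
(* Q has constant term 1, so 1 - Q is divisible by q and its power k + 1 by q^(k+1). *)
have /factor_theorem[s sE] : root (1 - Q) 0.
  by rewrite /root horner_coef0 coefB coefC Q0 subrr.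
have QG : Q * G = 1 - 'X^(k.+1) * s ^+ k.+1.
  rewrite -exprMn (mulrC 'X) -['X]subr0 -polyC0 -sE.
  by rewrite -[1 - (1 - Q) ^+ _]opprB subrX1 -mulNr -/G; congr (_ * _); ring.
have -> : P * R = P * G + 'X^(k.+1) * (P * (p * G + R * s ^+ k.+1)).
  have -> : P * R = P * (R * (Q * G + 'X^(k.+1) * s ^+ k.+1)).
    by rewrite QG subrK mulr1.
  by rewrite mulrDr mulrA RQ; ring.
by rewrite coefD coefXnM ltnSn addr0.
Qed.

Definition fermion r l mu (m : 'M[nat]_(r, l)) : {poly rat} :=
  'X^(Num.truncn (charge mu m)) *
    \prod_(a < r) \prod_(i < l | (i.+1 < l)%N)
      qbin (Num.truncn (vacancy mu m a i) + m a i) (m a i).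

Definition fermion' r l eta (m : 'M[nat]_(r, l)) : {poly rat} :=
  'X^(Num.truncn (energy m)) *
    \prod_(a < r) \prod_(i < l | (i.+1 < l)%N)
      qbin (Num.truncn (vacancy' eta m a i) + m a i) (m a i).

Definition denom r eta : {poly rat} :=
  \prod_(a < r) qpoch (multiplicity eta a.+1).

Lemma denom_coef0 r eta : (denom r eta)`_0 = 1.
Proof.
rewrite -horner_coef0 horner_prod big1 // => a _.
by rewrite horner_coef0 qpoch_coef0.
Qed.

Lemma shiftE r t M :
  let L := (r.+1 * M)%N in let N := (t * r.+1 * 'C(M, 2))%N in
  ((t * L)%N%:Z * (L%:Z - r.+1%:Z) %/ (2 * r.+1)%N%:Z)%Z = N /\
  N%:R = (t * L)%N%:R * (L%:R - r.+1%:R) / (2 * r.+1)%N%:R :> rat.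
Proof.
move=> L N.
have NE : N%:R = (t * L)%N%:R * (L%:R - r.+1%:R) / (2 * r.+1)%N%:R :> rat.
  rewrite /N /L !natrM bin2_rat; field.
  by rewrite nat1r pnatr_eq0.
split=> //; rewrite (_ : _ * _ = N%:Z * (2 * r.+1)%N%:Z) ?mulzK //.
apply: (@intr_inj rat); rewrite !rmorphM rmorphB /= -!pmulrn.
by rewrite bin2_rat /L !natrM; field.
Qed.

(** * Factorization of a single summand *)

Section GluedTerm.

Variables (r t d M : nat) (m : 'M[nat]_(r, t + d)).
Variables (m1 : 'M[nat]_(r, d)) (m2 : 'M[nat]_(r, t)) (eta : seq nat).
Hypotheses (t_gt0 : (0 < t)%N) (d_gt0 : (0 < d)%N) (gm : glued M m m1 m2).
Hypotheses (im1 : F'_index r.+1 d eta m1) (im2 : F'_index r.+1 t eta m2).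

Let L := (r.+1 * M)%N.
Let z (a : 'I_r) := multiplicity eta a.+1.
Let gap (a : 'I_r) := (ground M a - (tail m1 a 0 + tail m2 a 0))%N.

Lemma prod_glued a :
  \prod_(i < t + d | (i.+1 < t + d)%N)
      qbin (Num.truncn (vacancy (nseq L t) m a i) + m a i) (m a i)
  = qbin (z a + gap a) (gap a) *
    (\prod_(i < d | (i.+1 < d)%N)
      qbin (Num.truncn (vacancy' eta m1 a i) + m1 a i) (m1 a i)) *
    \prod_(i < t | (i.+1 < t)%N)
      qbin (Num.truncn (vacancy' eta m2 a i) + m2 a i) (m2 a i).
Proof.
have /F'_indexP[z1 _] := im1; have /F'_indexP[z2 _] := im2.
have vac_high (i : 'I_d) : vacancy (nseq L t) m a (rshift t i) = vacancy' eta m1 a i.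
  by rewrite vacancy_tail /= -addnS (sum_glued_high gm) // -z2 vacancy'_tail.
have vac_low (i j : 'I_t) : (i.+1 + j = t.-1)%N ->
    vacancy (nseq L t) m a (lshift d i) = vacancy' eta m2 a j.
  move=> ij; rewrite vacancy_tail /= (sum_glued_low gm) // -z2 vacancy'_tail //.
  by rewrite (_ : t - _ = j.+1)%N //=; lia.
have vac_mid (i : 'I_t) : i = t.-1 :> nat ->
    vacancy (nseq L t) m a (lshift d i) = (z a)%:R.
  move=> it; rewrite vacancy_tail /= (sum_glued_low gm) //.
  by rewrite (_ : t - _ = 0)%N ?big_ord0 ?subr0 -?z2 //; lia.
rewrite big_split_ord /= mulrAC; congr (_ * _); last first.
  apply: eq_big => [i|i _]; first by rewrite -addnS ltn_add2l.
  by rewrite vac_high (glued_entry_high gm).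
have tm : (t.-1 < t)%N by rewrite prednK.
(* Position t is stored in column t - 1; its factor has vacancy number [z a] and entry [gap a]. *)
rewrite (bigD1 (Ordinal tm)) /=; last by lia.
rewrite vac_mid // natrK (glued_entry_mid t_gt0 d_gt0 gm) //; congr (_ * _).
rewrite [RHS]big_mkcond [LHS]big_mkcond /=.
have rev_lt (i : 'I_t) : (t.-2 - i < t)%N by lia.
(* Reflection of the columns 0, ..., t - 2 that fixes the column t - 1, matching the backward
   reading of m2. *)
pose h (i : 'I_t) : 'I_t := if (i.+1 < t)%N then Ordinal (rev_lt i) else i.
have hK : involutive h.
  move=> i; apply: val_inj; rewrite /h; case: (ltnP i.+1 t) => /= it.
    by rewrite ifT /=; lia.
  by rewrite ifF //; lia.
rewrite [RHS](reindex_inj (inv_inj hK)) /=; apply: eq_bigr => i _.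
have -> : (i.+1 < t + d)%N && (i != Ordinal tm) = (i.+1 < t)%N.
  by rewrite -val_eqE /=; have := ltn_ord i; lia.
rewrite /h; case: ifP => it; last by rewrite it.
rewrite /= ifT; last by lia.
have ij : (i.+1 + Ordinal (rev_lt i) = t.-1)%N by rewrite /=; lia.
by rewrite (vac_low _ _ ij) (glued_entry_low t_gt0 d_gt0 gm a ij).
Qed.

Lemma charge_glued_nat : Num.truncn (charge (nseq L t) m)
  = (t * r.+1 * 'C(M, 2) + (Num.truncn (energy m1) + Num.truncn (energy m2)))%N.
Proof.
rewrite (charge_glued t_gt0 d_gt0 gm) -(proj2 (shiftE r t M)).
have /natrP[e1 ->] := energy_nat m1; have /natrP[e2 ->] := energy_nat m2.
by rewrite -!natrD !natrK addnA.
Qed.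

Lemma fermion_glued : fermion (nseq L t) m
  = 'X^(t * r.+1 * 'C(M, 2)) *
    ((fermion' eta m1 * fermion' eta m2) * \prod_(a < r) qbin (z a + gap a) (gap a)).
Proof.
rewrite /fermion charge_glued_nat !exprD; under eq_bigr do rewrite prod_glued.
rewrite !big_split /= /fermion'.
have AC (A B C D E G : {poly rat}) : A * (B * C) * (D * E * G) = A * (B * E * (C * G) * D).
  by ring.
exact: AC.
Qed.

Lemma coef_fermion_glued k : (forall a, k <= gap a)%N ->
  (fermion (nseq L t) m)`_(k + t * r.+1 * 'C(M, 2))
  = quo_series (fermion' eta m1 * fermion' eta m2) (denom r eta) k.
Proof.
move=> kg; have [p pE] := prod_qbin_modX z kg.
rewrite (quo_series_modX _ (denom_coef0 r eta) pE) fermion_glued coefXnM.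
by rewrite ltnNge leq_addl /= addnK.
Qed.

End GluedTerm.

(** * Finitely supported sums, and partitions encoded by multiplicities *)

Local Open Scope classical_set_scope.

(** The outer index set may be infinite. Both sums are first cut down to the projections of T, where
    they form a finite product. *)
Lemma fsbig_sigma (R : nmodType) (I J : choiceType) (A : set I) (Q : I -> set J)
    (T : set (I * J)) (h : I -> J -> R) :
  finite_set T -> (forall i j, T (i, j) -> A i /\ Q i j) ->
  (forall i j, A i -> Q i j -> ~ T (i, j) -> h i j = 0) ->
  \sum_(i \in A) \sum_(j \in Q i) h i j = \sum_(x \in T) h x.1 x.2.
Proof.
move=> finT TAQ h0.
pose A0 := [set x.1 | x in T]; pose Q0 := [set x.2 | x in T].
have finA0 : finite_set A0 by exact: finite_image.
have finQ0 : finite_set Q0 by exact: finite_image.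
transitivity (\sum_(i \in A0) \sum_(j \in Q0) if (i, j) \in T then h i j else 0).
  transitivity (\sum_(i \in A0) \sum_(j \in Q i) h i j).
    apply/esym/fsbig_widen => [_ [[i j] /TAQ[? _] <-] //|i [/= Ai nA0i]].
    apply: fsbig1 => j Qij; apply: h0 => // Tij; apply: nA0i.
    by exists (i, j).
  apply: eq_fsbigr => i /set_mem [[i' j'] /= Tij' ii'].
  have {}Ai : A i by rewrite -ii'; case: (TAQ _ _ Tij').
  transitivity (\sum_(j \in [set j | T (i, j)]) h i j).
    apply/esym/fsbig_widen => [j /TAQ[_ ?] //|j [/= Qij nT]].
    exact: h0.
  rewrite -[X in \sum_(j \in X) _ = _](_ : Q0 `&` [set j | T (i, j)] = _).
    by rewrite fsbig_mkcondr; apply: eq_fsbigr => j _; congr (if _ then _ else _).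
  by apply/seteqP; split=> [j [] //|j Tij]; split=> //; exists (i, j).
rewrite pair_fsbig //; apply/esym.
rewrite -[X in \sum_(j \in X) _ = _](_ : (A0 `*` Q0) `&` T = _).
  by rewrite fsbig_mkcondr; apply: eq_fsbigr => -[i j] _.
apply/seteqP; split=> [x [] //|x Tx]; split=> //.
by split; exists x.
Qed.

Lemma coef_fsum (J : choiceType) (D : set J) (P : J -> {poly rat}) k :
  finite_set D -> (\sum_(x \in D) P x)`_k = \sum_(x \in D) (P x)`_k.
Proof. by move=> finD; rewrite !fsbig_finite // coef_sum. Qed.

(** The divisibility condition on eta is left out here: it follows from the weights by
    [dvdn_weight]. *)
Definition bounded_part r : set (seq nat) :=
  [set eta | is_part eta /\ (head 0%N eta <= r)%N].

Lemma bounded_partP r eta : bounded_part r eta ->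
  forall x, x \in eta -> (0 < x <= r)%N.
Proof.
move=> [/andP[seta eta0] hd] x xeta.
rewrite lt0n (memPn eta0 _ xeta) /=.
case: eta seta hd xeta {eta0} => // y eta /= pth yr.
rewrite inE => /orP[/eqP -> //|xeta].
have geq_trans : transitive geq by move=> u v w vu uw; exact: leq_trans uw vu.
by have /allP/(_ _ xeta)/leq_trans := order_path_min geq_trans pth; apply.
Qed.

Lemma bounded_part_exists r (z : 'I_r -> nat) : exists eta,
  [/\ bounded_part r eta, forall a : 'I_r, multiplicity eta a.+1 = z a
    & sumn eta = \sum_(a < r) (a.+1 * z a)%N].
Proof.
pose s := flatten [seq nseq (z a) a.+1 | a <- enum 'I_r].
have sP x : x \in sort geq s -> (0 < x <= r)%N.
  by rewrite mem_sort => /flatten_mapP[a _]; rewrite mem_nseq => /andP[_ /eqP ->] /=.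
exists (sort geq s); split.
- split; last by case: (sort _ _) sP => // x s' /(_ x (mem_head _ _)) /andP[].
  apply/andP; split; first by apply: sort_sorted => x y; exact: leq_total.
  by apply/negP => /sP.
- move=> a; rewrite /multiplicity (permP (permEl (perm_sort _ _))) count_flatten.
  rewrite sumnE !big_map -enumT big_enum /= (bigD1 a) //= count_nseq /= eqxx mul1n.
  rewrite big1 ?addn0 // => b ba; rewrite count_nseq /= eqSS.
  by rewrite (_ : _ == _ = false) ?mul0n //; apply/negbTE.
- rewrite (perm_sumn (permEl (perm_sort _ _))) sumn_flatten sumnE !big_map -enumT big_enum.
  by apply: eq_bigr => a _; rewrite sumn_nseq.
Qed.

Lemma bounded_part_inj r eta eta' : bounded_part r eta -> bounded_part r eta' ->
  (forall a : 'I_r, multiplicity eta a.+1 = multiplicity eta' a.+1) -> eta = eta'.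
Proof.
move=> beta beta' eqm.
apply: (@sorted_eq _ geq); last first.
- apply/allP => x _ /=; have [/andP[x0 xr]|xout] := boolP (0 < x <= r)%N.
    have hx : (x.-1 < r)%N by lia.
    by have := eqm (Ordinal hx); rewrite /multiplicity /= prednK // => ->.
  have notin s : bounded_part r s -> count_mem x s = 0%N.
    by move=> bs; apply/count_memPn; apply: contra xout; exact: bounded_partP.
  by rewrite !notin.
- by case: beta' => /andP[].
- by case: beta => /andP[].
- by move=> x y /andP[yx xy]; apply/eqP; rewrite eqn_leq; apply/andP.
- by move=> u v w vu uw; exact: leq_trans uw vu.
Qed.

(* Pairing the equation for the weights with the first row of the inverse
   Cartan matrix, whose entries are 1 - b / n. *)
Lemma dvdn_weight r (z w : 'I_r -> nat) :
  (forall a, (z a)%:R = \sum_(b < r) cartan a.+1 b.+1 * (w b)%:R) ->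
  (r.+1 %| \sum_(a < r) a.+1 * z a)%N.
Proof.
case: r z w => [|r] z w zE; first by rewrite big_ord0 dvdn0.
have /(_ ord0) w0 := proj1 (@cartan_solve r.+2 (fun a => (z a)%:R) (fun a => (w a)%:R)) zE.
have e : (\sum_(a < r.+1) a.+1 * z a + r.+2 * w ord0 = r.+2 * \sum_(a < r.+1) z a)%N.
  apply/eqP; rewrite -(eqr_nat rat) natrD !natrM w0 !natr_sum !mulr_sumr -big_split.
  apply/eqP; apply: eq_bigr => a _ /=; rewrite /cartan_inv mul1n natrM.
  rewrite (_ : minn 1 a.+1 = 1%N); last by lia.
  by field; rewrite -natrD pnatr_eq0.
by rewrite -(dvdn_addl _ (dvdn_mulr (w ord0) (dvdnn r.+2))) e dvdn_mulr.
Qed.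

Lemma F'_index_inj r l eta eta' (m : 'M[nat]_(r, l)) :
  bounded_part r eta -> bounded_part r eta' ->
  F'_index r.+1 l eta m -> F'_index r.+1 l eta' m -> eta = eta'.
Proof.
move=> beta beta' /F'_indexP[zE _] /F'_indexP[zE' _].
apply: (bounded_part_inj beta beta') => a.
by apply/eqP; rewrite -(eqr_nat rat) zE zE'.
Qed.

Lemma finite_bounded_matrix r l k :
  finite_set [set m : 'M[nat]_(r, l) | forall a i, (m a i <= k)%N].
Proof.
pose f (m : 'M['I_k.+1]_(r, l)) : 'M[nat]_(r, l) := map_mx val m.
apply: (@sub_finite_set _ _ (f @` setT)); last exact: finite_image.
move=> m /= mk; exists (\matrix_(a, i) inord (m a i)) => //.
by apply/matrixP => a i; rewrite !mxE /= inordK // ltnS mk.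
Qed.

Lemma tail_le_truncn r l (m : 'M[nat]_(r, l)) a i :
  (tail m a i <= Num.truncn (energy m))%N.
Proof. by rewrite -(ler_nat rat) (truncnK (energy_nat m)) tail_le_energy. Qed.

(** * Both sides, coefficient by coefficient, as one sum over triples *)

Section Assembly.

Variables (r t d : nat).
Hypotheses (t_gt0 : (0 < t)%N) (d_gt0 : (0 < d)%N).

Let pairT : choiceType := ('M[nat]_(r, d) * 'M[nat]_(r, t))%type.

Definition parts : set (seq nat) :=
  [set eta | is_part eta /\ (head 0%N eta <= r)%N /\ (r.+1 %| sumn eta)%N].

(** Common finite index set for the limit and for the sum over eta: larger energies do not reach the
    coefficient k. *)
Definition triples k : set (seq nat * pairT) :=
  [set x | [/\ parts x.1, F'_index r.+1 d x.1 x.2.1, F'_index r.+1 t x.1 x.2.2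
    & (Num.truncn (energy x.2.1) + Num.truncn (energy x.2.2) <= k)%N]].

Definition term (k : nat) eta (p : pairT) : rat :=
  quo_series (fermion' eta p.1 * fermion' eta p.2) (denom r eta) k.

Lemma parts_bounded eta : parts eta -> bounded_part r eta.
Proof. by case=> ? []. Qed.

Lemma term_eq0 k eta (p : pairT) :
  (k < Num.truncn (energy p.1) + Num.truncn (energy p.2))%N -> term k eta p = 0.
Proof.
move=> kp; rewrite /term /quo_series /fermion'.
by rewrite mulrACA -exprD -mulrA coefXnM kp.
Qed.

Lemma finite_triples k : finite_set (triples k).
Proof.
pose box l := [set m : 'M[nat]_(r, l) | forall a i, (m a i <= k)%N].
(* m1 determines eta by [F'_index_inj], so choosing any compatible eta recovers the triple from its
   pair of matrices. *)
pose f (p : pairT) : seq nat * pairT :=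
  (xget [::] [set eta | bounded_part r eta /\ F'_index r.+1 d eta p.1], p).
apply: (@sub_finite_set _ _ (f @` (box d `*` box t))); last first.
  by apply: finite_image; apply: finite_setX; exact: finite_bounded_matrix.
move=> [eta [m1 m2]] [/= /parts_bounded beta im1 im2 ek]; exists (m1, m2).
  have entry l (m : 'M[nat]_(r, l)) a i : (m a i <= Num.truncn (energy m))%N.
    by rewrite (leq_trans _ (tail_le_truncn m a i)) // tail_rec leq_addr.
  by split=> a i /=; rewrite (leq_trans (entry _ _ _ _)) // (leq_trans _ ek) ?leq_addr ?leq_addl.
congr pair; case: xgetP => [eta' -> [beta' im1']|/(_ eta) []] //=.
exact: F'_index_inj im1' im1.
Qed.

Lemma quo_series_F' (k : nat) eta :
  quo_series (F' r.+1 d eta * F' r.+1 t eta) (denom r eta) k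
  = \sum_(p \in F'_index r.+1 d eta `*` F'_index r.+1 t eta) term k eta p.
Proof.
have fin1 := finite_F'_index r.+1 d eta; have fin2 := finite_F'_index r.+1 t eta.
rewrite /term /quo_series /=; set G := \sum_(i < k.+1) _.
rewrite -coef_fsum; last exact: finite_setX.
rewrite -mulr_fsuml; congr (nth 0 (polyseq (_ * G)) k).
rewrite -(pair_fsbig _ (fun m1 m2 => fermion' eta m1 * fermion' eta m2)) //.
rewrite /F' mulr_fsuml; apply: eq_fsbigr => m1 _.
by rewrite mulr_fsumr.
Qed.

Lemma sum_quo_series_F' (k : nat) :
  \sum_(eta \in parts)
     quo_series (F' r.+1 d eta * F' r.+1 t eta) (denom r eta) k
  = \sum_(x \in triples k) term k x.1 x.2.
Proof.
under eq_fsbigr do rewrite quo_series_F'.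
apply: fsbig_sigma; first exact: finite_triples.
  by move=> eta p [].
move=> eta p peta [im1 im2] nT; apply: term_eq0; rewrite ltnNge; apply/negP => ek.
exact: nT.
Qed.

Lemma finite_supp_F' (k : nat) : finite_set [set eta | parts eta /\
  quo_series (F' r.+1 d eta * F' r.+1 t eta) (denom r eta) k != 0].
Proof.
apply: (@sub_finite_set _ _ [set x.1 | x in triples k]).
  move=> eta [peta]; rewrite quo_series_F' => /fsbigN1 H.
  have [p [im1 im2] tn0] := H; exists (eta, p) => //; split=> //.
  by rewrite leqNgt; apply: contraNN tn0 => /term_eq0 ->.
exact/finite_image/finite_triples.
Qed.

Lemma F_split M (m : 'M[nat]_(r, t + d)) :
  F_index r.+1 (t + d) (nseq (r.+1 * M) t) m ->
  exists eta m1 m2, [/\ glued M m m1 m2, parts eta,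
    F'_index r.+1 d eta m1 & F'_index r.+1 t eta m2].
Proof.
move=> im; have [m1 [m2 gm]] := split_exists t_gt0 d_gt0 im.
have [eta [beta zE sumE]] := bounded_part_exists
  (fun a => Num.truncn (\sum_(k < t) ctail m2 a k)).
have z2 (a : 'I_r) : (multiplicity eta a.+1)%:R = \sum_(k < t) ctail m2 a k.
  by rewrite zE truncnK // (sum_ctail_nat t_gt0 d_gt0 gm).
have [im1 im2] := F_index_glued t_gt0 d_gt0 gm im z2.
exists eta, m1, m2; split=> //; case: beta => peta hd; split=> //; split=> //.
rewrite sumE (@dvdn_weight r _ (fun b => \sum_(k < t) tail m2 b k)%N) // => a.
rewrite -zE z2 -sum_ctail; by apply: eq_bigr => b _; rewrite natr_sum.
Qed.

(** Configurations of charge above k + N contribute nothing; gluing puts the others in bijection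
    with [triples k], and the summands agree by [coef_fermion_glued]. *)
Lemma coef_F M k : (3 * k <= M)%N ->
  (F r.+1 (t + d) (nseq (r.+1 * M) t))`_(k + t * r.+1 * 'C(M, 2))
  = \sum_(x \in triples k) term k x.1 x.2.
Proof.
move=> kM; set N := (t * _ * _)%N; set mu := nseq _ _.
rewrite /F coef_fsum; last exact: finite_F_index.
pose low := [set m | F_index r.+1 (t + d) mu m /\
                     (Num.truncn (charge mu m) <= k + N)%N].
transitivity (\sum_(m \in low) (fermion mu m)`_(k + N)).
  apply/esym/fsbig_widen => [m [] //|m [/= im nlow]]; rewrite /fermion coefXnM.
  by case: ltnP => // mk; case: nlow.
pose g (x : seq nat * pairT) : 'M[nat]_(r, t + d) :=
  xget (const_mx 0%N) [set m | glued M m x.2.1 x.2.2].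
(* [ground M a] is at least M >= 3k, while the two top tails together are at most the total energy,
   which is at most k; so the gap is at least k. *)
have small x : triples k x -> forall a : 'I_r,
    (k + (tail x.2.1 a 0 + tail x.2.2 a 0) <= ground M a)%N.
  move=> [_ _ _ ek] a.
  have Mg : (M <= ground M a)%N by rewrite leq_pmull // subn_gt0.
  apply: leq_trans (leq_trans kM Mg); rewrite mulSn leq_add2l.
  apply: leq_trans (leq_add (tail_le_truncn _ _ _) (tail_le_truncn _ _ _)) _.
  by rewrite (leq_trans ek) // leq_pmull.
have gapP x (Tx : triples k x) (a : 'I_r) :
    (k <= ground M a - (tail x.2.1 a 0 + tail x.2.2 a 0))%N.
  have := small x Tx a; set u := tail _ _ _; set v := tail _ _ _; lia.
have gP x : triples k x -> glued M (g x) x.2.1 x.2.2.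
  move=> Tx; apply: (@xgetPex _ (const_mx 0%N) [set m | glued M m x.2.1 x.2.2]).
  by apply: glued_exists => // a; apply: leq_trans (leq_addl _ _) (small x Tx a).
rewrite (reindex_fsbig g (triples k)); last split.
- apply: eq_fsbigr => x /set_mem Tx; case: (Tx) => _ im1 im2 _.
  exact: (coef_fermion_glued t_gt0 d_gt0 (gP x Tx) im1 im2 (gapP x Tx)).
- move=> x Tx; case: (Tx) => _ im1 im2 ek; split.
    exact: glued_F_index (gP x Tx) _ im1 im2.
  by rewrite (charge_glued_nat t_gt0 d_gt0 (gP x Tx)) addnC leq_add2r.
(* Injectivity: m determines m1 and m2, and m1 determines eta. *)
- move=> [eta [m1 m2]] [eta' [m1' m2']] /set_mem Tx /set_mem Tx' gE.
  have := gP _ Tx'; rewrite -gE => /(glued_uniq_split (gP _ Tx))[/= e1 e2].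
  case: Tx Tx' => /= /parts_bounded b im1 _ _ [/= /parts_bounded b' im1' _ _].
  by rewrite e1 in im1 *; rewrite e2 (F'_index_inj b b' im1 im1').
move=> m [im mk]; have [eta [m1 [m2 [gm peta im1 im2]]]] := F_split im.
have Tx : triples k (eta, (m1, m2)).
  split=> //=; move: mk.
  by rewrite (charge_glued_nat t_gt0 d_gt0 gm) addnC leq_add2r.
by exists (eta, (m1, m2)) => //; exact: glued_uniq (gP _ Tx) gm.
Qed.

(** Every configuration splits, so its charge is N plus two nonnegative energies. This settles the
    negative exponents of the limit. *)
Lemma coef_F_low M k : (k < t * r.+1 * 'C(M, 2))%N ->
  (F r.+1 (t + d) (nseq (r.+1 * M) t))`_k = 0.
Proof.
move=> kN; rewrite /F coef_fsum; last exact: finite_F_index.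
apply: fsbig1 => m im; have [eta [m1 [m2 [gm _ _ _]]]] := F_split im.
rewrite (charge_glued_nat t_gt0 d_gt0 gm) coefXnM ifT //.
by rewrite (leq_trans kN) ?leq_addr.
Qed.

End Assembly.

Theorem proposition4p14 (n l t : nat) (hn : (2 <= n)%N)
    (ht : (1 <= t)%N) (htl : (t <= l.-1)%N) :
  exists s : series,
    has_qlim (fun L => (n %| L)%N)
      (fun L => shifted_poly ((t * L)%N%:Z * (L%:Z - n%:Z) %/ (2 * n)%N%:Z)%Z
                  (F n l (nseq L t))) s
    /\
    has_qsum
      [set eta : seq nat | is_part eta /\ (head 0%N eta <= n.-1)%N
                           /\ (n %| sumn eta)%N]%classic
      (fun eta => quo_series (F' n (l - t) eta * F' n t eta)%R
                    (\prod_(a < n.-1) qpoch (multiplicity eta a.+1))%R) s.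
Proof.
case: n hn => // r _; have [d d0 ->] : exists2 d, (0 < d)%N & l = (t + d)%N.
  by exists (l - t)%N; lia.
rewrite addKn.
exists (fun j => if j is Posz k then \sum_(x \in @triples r t d k) term k x.1 x.2 else 0).
split=> -[k|k].
(* With L = nM this threshold is the bound M >= 3k of [coef_F]. *)
- exists (r.+1 * (3 * k))%N => L kL /dvdnP[M LE]; rewrite {}LE (mulnC M) in kL *.
  rewrite (proj1 (shiftE r t M)) /shifted_poly /= coef_F //.
  by rewrite -(leq_pmul2l (ltn0Sn r)).
- exists 0%N => L _ /dvdnP[M ->]; rewrite (mulnC M).
  rewrite (proj1 (shiftE r t M)) /shifted_poly.
  case E : (_ + _) => [k'|] //; rewrite coef_F_low //; lia.
- split; first exact: finite_supp_F'.
  by rewrite -sum_quo_series_F'.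
- split; last by rewrite fsbig1.
  by apply: (@sub_finite_set _ _ set0) => // eta [].
Qed.
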